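(* Let $A_1,\ldots,A_m$ be non-negative matrices that define operators on $l^2(R)$. If $m$ is even, then $$\|A_1\circ A_2\circ\cdots\circ A_m\|^2\le\rho(A_1^TA_2A_3^TA_4\cdots A_{m-1}^TA_m)\,\rho(A_1A_2^TA_3A_4^T\cdots A_{m-1}A_m^T)$$ $$=\rho(A_1^TA_2A_3^TA_4\cdots A_{m-1}^TA_m)\,\rho(A_mA_{m-1}^T\cdots A_4A_3^TA_2A_1^T).$$ If $m$ is odd, then $$\|A_1\circ A_2\circ\cdots\circ A_m\|^2\le\rho(A_1A_2^TA_3A_4^T\cdots A_{m-2}A_{m-1}^TA_mA_1^TA_2A_3^TA_4\cdots A_{m-2}^TA_{m-1}A_m^T).$$
   Context: $R$ is either $\{1,\ldots,n\}$ for some $n\in\mathbb{N}$ or $\mathbb{N}$, and $l^2(R)$ is the complex Hilbert space of square-summable sequences indexed by $R$ with the usual norm. A matrix $A=[a_{ij}]_{i,j\in R}$ (possibly infinite) is non-negative if $a_{ij}\ge0$ for all $i,j\in R$. A non-negative matrix $A$ defines an operator on $l^2(R)$ if $Ax\in l^2(R)$ for all $x\in l^2(R)$, where $(Ax)_i=\sum_{j\in R}a_{ij}x_j$; this operator is automatically bounded, and $A$ is identified with it. $\|A\|$ is the operator norm, $\rho(A)$ the spectral radius, $A^T=[a_{ji}]$ the transpose (which defines the adjoint operator); juxtaposition is the ordinary matrix product, and $A\circ B=[a_{ij}b_{ij}]_{i,j\in R}$ is the Hadamard product (which again defines an operator on $l^2(R)$). In the even case, in the first product the odd-indexed factors are transposed,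 in the second the even-indexed ones, and in the last product (indices decreasing from $m$ to $1$) the odd-indexed ones. In the odd case the product has $2m$ factors: first indices $1,\ldots,m$ in order with the even-indexed factors transposed, then indices $1,\ldots,m$ in order with the odd-indexed factors transposed. *)

(* Defs.v *)
From mathcomp Require Import all_boot all_order all_algebra.
From mathcomp Require Import all_classical all_reals ereal esum numfun.
From mathcomp Require Import complex.

Set Implicit Arguments.
Unset Strict Implicit.
Unset Printing Implicit Defensive.
Import Order.TTheory GRing.Theory Num.Theory.

Local Open Scope classical_set_scope.
Local Open Scope complex_scope.
Local Open Scope ring_scope.

(* [Segment n] is {1, ..., n.+1}, encoded by 'I_n.+1 = {0, ..., n}, so that
   the finite index sets are exactly the non-empty initial segments. *)
Inductive index_set := Segment of nat | Naturals.

Definition index_type (r : index_set) : countType :=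
  match r with Segment n => 'I_n.+1 | Naturals => nat end.

Coercion index_type : index_set >-> countType.

Section SequenceSpace.
Variables (R : realType) (I : countType).
Implicit Types (x y : I -> R[i]) (A B : I -> I -> R).

(* Unordered sums over I. They are meaningful for absolutely summable families
   (for scalars, unconditional and absolute convergence coincide). *)
Definition rsum (f : I -> R) : R :=
  fine (\esum_(i in setT) (EFin \o f)^\+ i - \esum_(i in setT) (EFin \o f)^\- i)%E.

Definition csum (f : I -> R[i]) : R[i] :=
  rsum (fun i => complex.Re (f i)) +i* rsum (fun i => complex.Im (f i)).

Definition csummable (f : I -> R[i]) : Prop :=
  (\esum_(i in setT) (Normc.normc (f i))%:E < +oo)%E.

Definition l2 x : Prop :=
  (\esum_(i in setT) (Normc.normc (x i) ^+ 2)%:E < +oo)%E.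

Definition l2norm x : R :=
  Num.sqrt (fine (\esum_(i in setT) (Normc.normc (x i) ^+ 2)%:E)%E).

(* An operator on l2 is represented by a map on all families, of which only
   the restriction to l2 is relevant. *)
Definition bounded_operator (T : (I -> R[i]) -> (I -> R[i])) : Prop :=
  [/\ forall x, l2 x -> l2 (T x),
      forall (a : R[i]) x y, l2 x -> l2 y -> T (a *: x + y) = a *: T x + T y
    & exists M : R, forall x, l2 x -> l2norm (T x) <= M * l2norm x].

(* The suprema below are of bounded sets: a non-negative matrix that defines an
   operator on l2 is automatically bounded, and so is its spectrum. *)
Definition opnorm (T : (I -> R[i]) -> (I -> R[i])) : R :=
  sup [set l2norm (T x) | x in [set x | l2 x /\ l2norm x <= 1]].

Definition resolvent_set (T : (I -> R[i]) -> (I -> R[i])) : set R[i] :=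
  [set z | exists2 S, bounded_operator S &
     forall x, l2 x -> S (z *: x - T x) = x /\ z *: S x - T (S x) = x].

Definition spectrum (T : (I -> R[i]) -> (I -> R[i])) : set R[i] :=
  ~` resolvent_set T.

Definition spectral_radius (T : (I -> R[i]) -> (I -> R[i])) : R :=
  sup [set Normc.normc z | z in spectrum T].

Definition nonneg_matrix A : Prop := forall i j, 0 <= A i j.

Definition matrix_op A x : I -> R[i] :=
  fun i => csum (fun j => (A i j)%:C * x j).

Definition defines_operator A : Prop :=
  forall x, l2 x ->
    (forall i, csummable (fun j => (A i j)%:C * x j)) /\ l2 (matrix_op A x).

Definition matrix_norm A : R := opnorm (matrix_op A).

Definition matrix_rho A : R := spectral_radius (matrix_op A).

Definition transpose A : I -> I -> R := fun i j => A j i.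

Definition matrix_one : I -> I -> R := fun i j => (i == j)%:R.

Definition matrix_mul A B : I -> I -> R :=
  fun i k => rsum (fun j => A i j * B j k).

(* Ordered product of the F k, for k along s, bracketed to the right; bracketing
   is immaterial for non-negative matrices that define operators. *)
Definition matrix_prod (s : seq nat) (F : nat -> I -> I -> R) : I -> I -> R :=
  \big[matrix_mul/matrix_one]_(k <- s) F k.

Definition hadamard_prod (s : seq nat) (F : nat -> I -> I -> R) : I -> I -> R :=
  fun i j => \prod_(k <- s) F k i j.

Definition transpose_odd (F : nat -> I -> I -> R) : nat -> I -> I -> R :=
  fun k => if odd k then transpose (F k) else F k.

Definition transpose_even (F : nat -> I -> I -> R) : nat -> I -> I -> R :=
  fun k => if odd k then F k else transpose (F k).

End SequenceSpace.

(* Main.v *)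
(* For a non-negative matrix [B] bounded on l2, [rho(B)] is the infimum of the
   [t > 0] such that the powers of [B / t] are uniformly bounded. If the powers of
   [B / t] are bounded, the Neumann series at every [z] with [|z| > t] is dominated
   by a bounded positive matrix. Conversely, let [t0] be the infimum of the good
   [t]: were [t0] in the resolvent set, the sums [G = \sum_n t^-(n+1) B^n] would
   stay bounded as [t] decreases to [t0], and [(n + 1) t^-(n+2) B^n <= G^2] entrywise
   would make some power of [B / t0] a strict contraction. This description of
   [rho] is invariant under transposition and under [X Y |-> Y X].

   Let [H] be the Hadamard product. The squared norms of [x], [H x], [H^T H x], ...
   form a log-convex sequence, so [|H x|^2 / |x|^2] is at most the exponential
   growth rate of [<x, (H^T H)^N x>]. A word in [H] and [H^T] is entrywise at most the
   Hadamard product of [m] words: in the [k]-th one, the [p]-th factor is the matrix of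
   index [k + p] modulo [m], transposed every second time. For words of length
   [2m] these are cyclic permutations of the products in the theorem (of their
   squares, if [m] is even), and the entries of a Hadamard product of powers grow at
   most like the product of the powers of their spectral radii. *)
Require Import Defs.
From mathcomp Require Import all_boot all_order all_algebra.
From mathcomp Require Import all_classical all_reals ereal esum numfun.
From mathcomp Require Import sequences topology normedtype.
From mathcomp Require Import complex lra ring.

Set Implicit Arguments.
Unset Strict Implicit.
Unset Printing Implicit Defensive.
Import Order.TTheory GRing.Theory Num.Theory.

Local Open Scope classical_set_scope.
Local Open Scope complex_scope.
Local Open Scope ring_scope.

Lemma bernoulli (R : realFieldType) (h : R) n :
  -1 <= h -> 1 + n%:R * h <= (1 + h) ^+ n.
Proof.
move=> h1; elim: n => [|n IH]; first by rewrite mul0r addr0.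
rewrite exprS; apply: (@le_trans _ _ ((1 + h) * (1 + n%:R * h))); last first.
  by apply: ler_wpM2l => //; lra.
have n0 : (0 <= n%:R :> R) by []; rewrite -natr1; have := sqr_ge0 h; nra.
Qed.

(** * Extended sums *)

Section ExtendedSums.
Local Open Scope ereal_scope.
Context {R : realType}.
Implicit Types T : choiceType.

Lemma le_esum_term T (f : T -> \bar R) i : (forall i, 0 <= f i) ->
  f i <= \esum_(i in setT) f i.
Proof.
move=> f0; apply: esum_ge; exists [set i]; first by split=> //; exact: finite_set1.
by rewrite fsbig_set1.
Qed.

Lemma esumZl T (c : \bar R) (f : T -> \bar R) :
  0 <= c -> (forall i, 0 <= f i) ->
  \esum_(i in setT) (c * f i) = c * \esum_(i in setT) f i.
Proof.
case: c => [r||] // r0 f0.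
  rewrite lee_fin in r0.
  rewrite /esum -ereal_supZl//; last first.
    by apply/set0P; exists (\sum_(x \in set0) f x); exists set0 => //; exact: fsets_set0.
  congr ereal_sup; rewrite image_comp; apply: eq_imagel => A [finA _] /=.
  by rewrite ge0_mule_fsumr.
(* For [c = +oo] both sides are [+oo], unless [f] vanishes identically and [+oo * 0 = 0] applies. *)
have [f00|/existsNP[i /eqP fi0]] := pselect (forall i, f i = 0).
  by rewrite !esum1 ?mule0// => i _; rewrite f00 ?mule0.
have {}fi0 : 0 < f i by rewrite lt0e fi0 f0.
have s0 : 0 < \esum_(i in setT) f i by exact: lt_le_trans (le_esum_term i f0).
rewrite gt0_mulye//; apply/eqP; rewrite -leye_eq.
have := @le_esum_term _ (fun i => +oo * f i) i; rewrite gt0_mulye//; apply => j.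
by rewrite mule_ge0.
Qed.

Lemma esumZr T (c : \bar R) (f : T -> \bar R) :
  0 <= c -> (forall i, 0 <= f i) ->
  \esum_(i in setT) (f i * c) = (\esum_(i in setT) f i) * c.
Proof.
by move=> c0 f0; rewrite muleC -esumZl//; apply: eq_esum => i _; rewrite muleC.
Qed.

Lemma esum_delta T (f : T -> \bar R) i :
  (forall j, j != i -> f j = 0) -> 0 <= f i -> \esum_(j in setT) f j = f i.
Proof.
move=> fj fi; rewrite -[RHS](@esum_set1 _ _ i f)// [RHS]esum_mkcond.
apply: eq_esum => j _; case: ifPn => //; rewrite notin_setE/= => /eqP ji.
exact: fj.
Qed.

Lemma exchange_esum (T U : choiceType) (f : T -> U -> \bar R) :
  (forall i j, 0 <= f i j) ->
  \esum_(i in setT) \esum_(j in setT) f i j =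
  \esum_(j in setT) \esum_(i in setT) f i j.
Proof.
move=> f0; rewrite (@esum_esum _ _ _ setT (fun=> setT))//.
rewrite (@esum_esum _ _ _ setT (fun=> setT) (fun j i => f i j))//.
rewrite (@reindex_esum _ _ _ ([set: U] `*`` (fun=> [set: T])) _
  (fun x : U * T => (x.2, x.1)))//; split=> //=.
- by move=> [i1 i2] [j1 j2] /= _ _ [] -> ->.
- by move=> [i1 i2] _ /=; exists (i2, i1).
Qed.

(** The two sides differ by [c * (a - c^-1 * b) ^+ 2]; if [a] or [b] is infinite, so is the
    right-hand side. *)
Lemma ge0_mul_amgm (a b : \bar R) (c : R) : (0 < c)%R -> 0 <= a -> 0 <= b ->
  2%:E * (a * b) <= c%:E * (a * a) + c^-1%:E * (b * b).
Proof.
move=> c0; have c1 : (0 < c^-1)%R by rewrite invr_gt0.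
case: a => [a||]//; case: b => [b||]//.
- rewrite !lee_fin => a0 b0.
  have -> : (c * (a * a) + c^-1 * (b * b) =
             2 * (a * b) + c * (a - c^-1 * b) ^+ 2)%R by field; rewrite gt_eqF.
  by rewrite lerDl mulr_ge0// ?sqr_ge0// ltW.
- by move=> _ _; rewrite mulyy [X in _ + X]gt0_muley ?lte_fin// addey ?leey.
- by move=> _ _; rewrite mulyy [X in X + _]gt0_muley ?lte_fin//; exact: leey.
- by move=> _ _; rewrite mulyy !gt0_muley ?lte_fin.
Qed.

(** Sum [ge0_mul_amgm] over the index, then choose the weight. The form with products avoids square
    roots of infinite sums. *)
Lemma esum_CauchySchwarz T (f g : T -> \bar R) :
  (forall i, 0 <= f i) -> (forall i, 0 <= g i) ->
  (\esum_(i in setT) (f i * g i)) * (\esum_(i in setT) (f i * g i)) <=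
  (\esum_(i in setT) (f i * f i)) * (\esum_(i in setT) (g i * g i)).
Proof.
move=> f0 g0.
have fg0 i : 0 <= f i * g i by rewrite mule_ge0.
have ff0 i : 0 <= f i * f i by rewrite mule_ge0.
have gg0 i : 0 <= g i * g i by rewrite mule_ge0.
have amgm c : (0 < c)%R -> 2%:E * (\esum_(i in setT) (f i * g i)) <=
    c%:E * (\esum_(i in setT) (f i * f i)) + c^-1%:E * (\esum_(i in setT) (g i * g i)).
  move=> c0; have c1 : (0 < c^-1)%R by rewrite invr_gt0.
  rewrite -!esumZl ?lee_fin ?(ltW c0) ?(ltW c1)//.
  rewrite -esumD; last 2 first.
  - by move=> i _; rewrite mule_ge0// lee_fin ltW.
  - by move=> i _; rewrite mule_ge0// lee_fin ltW.
  by apply: le_esum => i _; exact: ge0_mul_amgm.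
(* If one sum of squares is 0, the right-hand side is 0 even when the other sum is [+oo], so the
   left-hand side has to vanish as well. *)
have zero (h k : T -> \bar R) : (forall i, 0 <= h i) -> \esum_(i in setT) (h i * h i) = 0 ->
    \esum_(i in setT) (h i * k i) = 0.
  move=> h0 hh; apply: esum1 => i _.
  suff -> : h i = 0 by rewrite mul0e.
  have : h i * h i <= 0.
    by rewrite -hh; apply: (@le_esum_term _ (fun i => h i * h i)) => j; rewrite mule_ge0.
  have := h0 i; case: (h i) => [r||]//; rewrite -EFinM !lee_fin => r0 rr.
  congr EFin; apply/eqP; rewrite -sqrf_eq0 expr2 eq_le rr mulr_ge0//.
move: (esum_ge0 (fun i (_ : setT i) => ff0 i)) (esum_ge0 (fun i (_ : setT i) => gg0 i)).
move: (esum_ge0 (fun i (_ : setT i) => fg0 i)).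
have [ff|ff] := eqVneq (\esum_(i in setT) (f i * f i)) 0.
  by rewrite (zero f g)// ff !mul0e.
have [gg|gg] := eqVneq (\esum_(i in setT) (g i * g i)) 0.
  rewrite (_ : \esum_(i in setT) (f i * g i) = 0) ?gg ?mule0 ?mul0e//.
  by rewrite -(zero g f)//; apply: eq_esum => i _; rewrite muleC.
move: amgm ff gg; case: (\esum_(i in setT) (f i * f i)) => [a||]//; last first.
  by move=> _ _ b0 c0 _ c1; rewrite gt0_mulye ?leey// lt0e b0 c1.
case: (\esum_(i in setT) (g i * g i)) => [b||]//; last first.
  by move=> _ b0 _ c0 c1 _; rewrite gt0_muley ?leey// lt0e b0 c1.
case: (\esum_(i in setT) (f i * g i)) => [c||]//; last first.
  by move=> /(_ 1%R)/(_ ltr01); rewrite gt0_muley ?lte_fin// -!EFinM -EFinD leye_eq.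
rewrite !eqe !lee_fin => amgm a0 b0 c_ge0 a_ge0 b_ge0.
have {}a0 : (0 < a)%R by rewrite lt0r a0.
have [->|cn0] := eqVneq c 0%R; first by rewrite !mul0r mulr_ge0.
have c0 : (0 < c)%R by rewrite lt0r cn0.
(* The weight [c / a] turns the inequality into [2 * c <= c + a * b / c]. *)
have := amgm (c / a)%R (divr_gt0 c0 a0); rewrite -!EFinM -EFinD !lee_fin.
rewrite divfK ?gt_eqF// invf_div => H.
have {}H : (c <= a * b / c)%R by rewrite mulrAC; lra.
by rewrite -ler_pdivlMr.
Qed.

Lemma esum_nat_recl (f : nat -> \bar R) : (forall i, 0 <= f i) ->
  \esum_(i in setT) f i = f 0%N + \esum_(i in setT) f i.+1.
Proof.
move=> f0; rewrite (esumID [set 0%N])// setTI esum_set1//; congr +%E.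
rewrite setTI; apply: reindex_esum; split=> //=.
- by move=> i j _ _ [].
- by move=> [|i]//= _; exists i.
Qed.

Lemma esum_nat_ge_sum (f : nat -> \bar R) n : (forall i, 0 <= f i) ->
  \sum_(i < n) f i <= \esum_(i in setT) f i.
Proof.
elim: n f => [|n IH] f f0; first by rewrite big_ord0 esum_ge0.
by rewrite big_ord_recl esum_nat_recl// leeD2l// IH.
Qed.

End ExtendedSums.

(** * Operators on non-negative vectors *)

Section PositiveOperators.
Local Open Scope ereal_scope.
Context {R : realType} {I : choiceType}.
Implicit Types (v w : I -> \bar R) (T U : (I -> \bar R) -> I -> \bar R).

Definition nneg_vec v := forall i, 0 <= v i.

Definition ip v w := \esum_(i in setT) (v i * w i).

Definition unit_vec (i : I) : I -> \bar R := fun j => if j == i then 1 else 0.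

(** Since [c] is positive, the estimate is vacuous where [ip v v] is [+oo]; no domain has to be
    specified. *)
Definition op_bound T (c : R) := [/\ (0 < c)%R,
  forall v, nneg_vec v -> nneg_vec (T v)
  & forall v, nneg_vec v -> ip (T v) (T v) <= (c ^+ 2)%:E * ip v v].

Definition power_bound T (t : R) :=
  (0 < t)%R /\ exists C : R, forall n, op_bound (iter n T) (C * t ^+ n)%R.

Lemma ip_ge0 v w : nneg_vec v -> nneg_vec w -> 0 <= ip v w.
Proof. by move=> v0 w0; apply: esum_ge0 => i _; rewrite mule_ge0. Qed.

Lemma ipC v w : ip v w = ip w v.
Proof. by apply: eq_esum => i _; rewrite muleC. Qed.

Lemma le_ip v v' w w' : nneg_vec v -> nneg_vec w ->
  (forall i, v i <= v' i) -> (forall i, w i <= w' i) -> ip v w <= ip v' w'.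
Proof. by move=> v0 w0 vv ww; apply: le_esum => i _; rewrite lee_pmul. Qed.

Lemma sqr_le_ip v i : nneg_vec v -> v i * v i <= ip v v.
Proof.
move=> v0; apply: (@le_esum_term _ _ (fun i => v i * v i)) => j.
by rewrite mule_ge0.
Qed.

Lemma ip_lty_fin v i : nneg_vec v -> ip v v < +oo -> v i \is a fin_num.
Proof.
move=> v0 /(le_lt_trans (sqr_le_ip i v0)); have := v0 i.
by case: (v i) => // _; rewrite mulyy ltxx.
Qed.

Lemma unit_vec_ge0 i : nneg_vec (unit_vec i).
Proof. by move=> j; rewrite /unit_vec; case: ifP. Qed.

Lemma ip_unitl i v : nneg_vec v -> ip (unit_vec i) v = v i.
Proof.
move=> v0; rewrite /ip (@esum_delta _ _ _ i) /unit_vec ?eqxx ?mul1e// => j /negPf->.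
by rewrite mul0e.
Qed.

Lemma ip_unit i : ip (unit_vec i) (unit_vec i) = 1.
Proof. by rewrite ip_unitl ?/unit_vec ?eqxx//; exact: unit_vec_ge0. Qed.

Lemma op_bound_ext T U c : (forall v, nneg_vec v -> T v = U v) ->
  op_bound T c -> op_bound U c.
Proof.
move=> TU [c0 T0 Tc]; split=> // v v0; rewrite -?TU//; [exact: T0|exact: Tc].
Qed.

Lemma op_bound_le T a b : (a <= b)%R -> op_bound T a -> op_bound T b.
Proof.
move=> ab [a0 T0 Ta]; split => // [|v v0]; first exact: lt_le_trans ab.
apply: le_trans (Ta v v0) _; rewrite lee_wpmul2r ?ip_ge0//.
by rewrite lee_fin lerXn2r// nnegrE ltW// (lt_le_trans a0).
Qed.

Lemma op_bound_comp T U a b : op_bound T a -> op_bound U b ->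
  op_bound (T \o U) (a * b)%R.
Proof.
move=> [a0 T0 Ta] [b0 U0 Ub]; split=> [||v v0]; first exact: mulr_gt0.
  by move=> v v0; apply/T0/U0.
apply: le_trans (Ta _ (U0 _ v0)) _; rewrite exprMn (EFinM (a ^+ 2)) -(muleA (a ^+ 2)%:E).
by apply: lee_wpmul2l; [rewrite lee_fin sqr_ge0|exact: Ub].
Qed.

Lemma op_bound_id : op_bound id 1.
Proof. by split=> // v v0; rewrite expr1n mul1e. Qed.

Lemma op_bound_iter T c n : op_bound T c -> op_bound (iter n T) (c ^+ n)%R.
Proof.
move=> Tc; elim: n => [|n IH]; first exact: op_bound_id.
by rewrite exprS; exact: op_bound_comp.
Qed.

(** Let [w'] be [U y] cut off to a finite set. Then [|w'|^2 = <w', U y> = <T w', y> <= c |w'| |y|],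
    and [|w'|] can be cancelled because the cut-off keeps it finite. *)
Lemma op_bound_adjoint T U c : op_bound T c ->
  (forall v, nneg_vec v -> nneg_vec (U v)) ->
  (forall v w, nneg_vec v -> nneg_vec w -> ip (T v) w = ip v (U w)) ->
  op_bound U c.
Proof.
move=> [c0 T0 Tc] U0 TU; split=> // y y0.
have [yoo|yfin] := eqVneq (ip y y) +oo.
  by rewrite yoo gt0_muley ?leey// lte_fin exprn_gt0.
have {yfin} [N yN] : exists N, ip y y = N%:E.
  by move: yfin (ip_ge0 y0 y0); case: (ip y y) => [N||]// _ _; exists N.
have N0 : (0 <= N)%R by rewrite -lee_fin -yN ip_ge0.
have key w' : nneg_vec w' ->
    ip w' (U y) * ip w' (U y) <= (c ^+ 2)%:E * ip w' w' * N%:E.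
  move=> w'0; rewrite -TU// -yN; apply: le_trans (esum_CauchySchwarz _ _) _ => //.
    exact: T0.
  by rewrite lee_wpmul2r ?ip_ge0// Tc.
(* Testing [key] against a unit vector bounds each single entry. *)
have wfin i : U y i \is a fin_num.
  have := key _ (unit_vec_ge0 i); rewrite ip_unit ip_unitl; last exact: U0.
  by have := U0 _ y0 i; case: (U y i).
apply: ge_ereal_sup => _ [A [finA _] <-]; rewrite yN.
pose w' i := if i \in A then U y i else 0.
have w'0 : nneg_vec w' by move=> i; rewrite /w'; case: ifP => // _; exact: U0.
have sE : \sum_(x \in A) (U y x * U y x) = ip w' (U y).
  rewrite -esum_fset//; last by move=> i _; rewrite mule_ge0// U0.
  rewrite esum_mkcond; apply: eq_esum => i _; rewrite /w'.
  by case: ifP => // _; rewrite mul0e.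
have ww : ip w' w' = ip w' (U y).
  by apply: eq_esum => i _; rewrite /w'; case: ifP => // _; rewrite !mul0e.
have : ip w' (U y) \is a fin_num.
  by rewrite -sE fsbig_finite//=; apply/sum_fin_numP => i _ _; rewrite fin_numM.
rewrite sE; have := key _ w'0; rewrite ww.
case: (ip w' (U y)) (ip_ge0 w'0 (U0 _ y0)) => [s||]//.
rewrite -!EFinM !lee_fin => s0 sN _.
have [->|sn0] := eqVneq s 0%R; first by rewrite mulr_ge0 ?sqr_ge0.
by rewrite -(@ler_pM2l _ s) ?lt0r ?sn0// (le_trans sN)// mulrA [(s * _)%R]mulrC.
Qed.

Lemma power_bound_ext T U t : (forall v, nneg_vec v -> T v = U v) ->
  power_bound T t -> power_bound U t.
Proof.
move=> TU [t0 [C TC]]; split=> //; exists C => n; apply: op_bound_ext (TC n) => v v0.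
have [_ T0 _] := TC 1%N.
have iT0 m : nneg_vec (iter m T v) by elim: m => //= m; exact: T0.
by elim: n => //= n IH; rewrite -IH TU.
Qed.

Lemma op_bound_power T c : op_bound T c -> power_bound T c.
Proof.
move=> Tc; split; first by case: Tc.
by exists 1%R => n; rewrite mul1r; exact: op_bound_iter.
Qed.

(** [(U T)^(n+1) = U (T U)^n T]. The summand 1 in the constant takes care of the power 0. *)
Lemma power_bound_cycle T U a b t : op_bound T a -> op_bound U b ->
  power_bound (T \o U) t -> power_bound (U \o T) t.
Proof.
move=> Ta Ub [t0 [C TU]]; split=> //.
(* The bound on the power 0 shows that [C] is positive. *)
have [a0 _ _] := Ta; have [b0 _ _] := Ub; have [C0 _ _] := TU 0%N.
rewrite expr0 mulr1 in C0.
exists (C * a * b / t + 1)%R => -[|n].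
  apply: (op_bound_le _ op_bound_id); rewrite expr0 mulr1 lerDr.
  by rewrite divr_ge0 ?mulr_ge0// ltW.
have -> : iter n.+1 (U \o T) = U \o (iter n (T \o U) \o T).
  apply/funext => v /=; elim: n v => [|n IH] v //=.
  by rewrite -IH.
apply: op_bound_le (op_bound_comp Ub (op_bound_comp (TU n) Ta)).
have -> : ((C * a * b / t + 1) * t ^+ n.+1 = b * (C * t ^+ n * a) + t ^+ n.+1)%R.
  by rewrite exprS; field; rewrite gt_eqF.
by rewrite lerDl exprn_ge0// ltW.
Qed.

Lemma power_bound_sqr T t : power_bound T t -> power_bound (T \o T) (t ^+ 2)%R.
Proof.
move=> [t0 [C TC]]; split; first exact: exprn_gt0.
exists C => n; rewrite -exprM mulnC.
rewrite (_ : iter n (T \o T) = iter (n * 2) T)//.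
by apply/funext => v; elim: n => //= n ->.
Qed.

Lemma power_bound_adjoint T U t : power_bound T t ->
  (forall v, nneg_vec v -> nneg_vec (U v)) ->
  (forall v w, nneg_vec v -> nneg_vec w -> ip (T v) w = ip v (U w)) ->
  power_bound U t.
Proof.
move=> [t0 [C TC]] U0 TU; split=> //; exists C => n.
have [_ T0 _] := TC 1%N.
have iU0 m v : nneg_vec v -> nneg_vec (iter m U v).
  by move=> v0; elim: m => //= m; exact: U0.
apply: op_bound_adjoint (TC n) (iU0 n) _ => v w v0 w0.
elim: n w w0 => //= n IH w w0.
have [_ iT0 _] := TC n.
by rewrite TU//; [rewrite IH -?iterSr//; exact: U0|exact: iT0].
Qed.

(* The remainder of [n] modulo [N] costs at most [(1 + b / s) ^+ N]. *)
Lemma power_bound_root T b s N : (0 < N)%N -> (0 < s)%R -> op_bound T b ->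
  op_bound (iter N T) (s ^+ N)%R -> power_bound T s.
Proof.
move=> N0 s0 Tb TN; split=> //; exists ((1 + b / s) ^+ N)%R => n.
have b0 : (0 < b)%R by case: Tb.
have -> : iter n T = iter (n %% N) T \o iter (n %/ N) (iter N T).
  by apply/funext => v; rewrite {1}(divn_eq n N) addnC iterD iterM.
apply: op_bound_le (op_bound_comp (op_bound_iter (n %% N) Tb) (op_bound_iter (n %/ N) TN)).
rewrite -exprM (mulnC N) [in (s ^+ n)%R](divn_eq n N) exprD mulrCA mulrC.
rewrite ler_wpM2l ?exprn_ge0 ?(ltW s0)//.
have bs : (0 <= b / s)%R by rewrite divr_ge0 ?ltW.
rewrite -ler_pdivrMr ?exprn_gt0// -expr_div_n.
apply: (@le_trans _ _ ((1 + b / s) ^+ (n %% N)))%R.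
  by rewrite lerXn2r ?nnegrE ?addr_ge0// lerDr.
by rewrite ler_weXn2l ?lerDl// ltnW// ltn_mod.
Qed.

End PositiveOperators.

Section WeightedSums.
Local Open Scope ereal_scope.
Context {R : realType} {I : choiceType}.

Lemma esum_geometric (q : R) : (0 <= q < 1)%R ->
  \esum_(n in [set: nat]) (q ^+ n)%:E <= ((1 - q)^-1)%:E.
Proof.
move=> /andP[q0 q1]; have qn0 n : 0 <= (q ^+ n)%:E by rewrite lee_fin exprn_ge0.
rewrite -nneseries_esumT//; apply: lime_le; first exact: is_cvg_nneseries.
apply: nearW => n; rewrite sumEFin lee_fin.
rewrite -[leRHS]mul1r ler_pdivlMr ?subr_gt0// mulrC big_mkord.
by rewrite -opprB mulNr -subrX1 opprB lerBlDr lerDl exprn_ge0.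
Qed.

(** Coordinatewise this is Cauchy-Schwarz for the weights [c], each split into two factors
    [sqrt (c n)]; then the sums over [i] and [n] are exchanged. *)
Lemma ip_weighted_sum (c : nat -> R) (v : nat -> I -> \bar R) :
  (forall n, 0 <= c n)%R -> (forall n, nneg_vec (v n)) ->
  ip (fun i => \esum_(n in setT) ((c n)%:E * v n i))
     (fun i => \esum_(n in setT) ((c n)%:E * v n i)) <= (\esum_(n in setT) (c n)%:E) *
            (\esum_(n in setT) ((c n)%:E * ip (v n) (v n))).
Proof.
move=> c0 v0; set s := fun i => _.
have cv0 n i : 0 <= (c n)%:E * (v n i * v n i) by rewrite !mule_ge0 ?lee_fin// v0.
have -> : \esum_(n in setT) ((c n)%:E * ip (v n) (v n)) =
          \esum_(i in setT) \esum_(n in setT) ((c n)%:E * (v n i * v n i)).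
  rewrite exchange_esum//; apply: eq_esum => n _; rewrite -esumZl ?lee_fin//.
  by move=> i; rewrite mule_ge0// v0.
rewrite -esumZl; last 2 first.
- by apply: esum_ge0 => n _; rewrite lee_fin.
- by move=> i; apply: esum_ge0 => n _.
apply: le_esum => i _.
pose r n := (Num.sqrt (c n))%:E; have rr n : r n * r n = (c n)%:E.
  by rewrite -EFinM -expr2 sqr_sqrtr.
have r0 n : 0 <= r n by rewrite lee_fin sqrtr_ge0.
have := @esum_CauchySchwarz R nat r (fun n => r n * v n i) r0.
have -> : \esum_(n in setT) (r n * (r n * v n i)) = s i.
  by apply: eq_esum => n _; rewrite muleA rr.
have -> : \esum_(n in setT) (r n * v n i * (r n * v n i)) =
          \esum_(n in setT) ((c n)%:E * (v n i * v n i)).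
  by apply: eq_esum => n _; rewrite muleACA rr.
have -> : \esum_(n in setT) (r n * r n) = \esum_(n in setT) (c n)%:E.
  by apply: eq_esum => n _.
by apply => n; rewrite mule_ge0// v0.
Qed.

End WeightedSums.

(** * Non-negative matrices acting on extended non-negative vectors *)

Section PositiveMatrices.
Local Open Scope ereal_scope.
Context {R : realType} {I : countType}.
Implicit Types (A B : I -> I -> R) (v w : I -> \bar R).

(** Extended values make the product meaningful for every non-negative vector, before any
    boundedness is known. *)
Definition mv A v : I -> \bar R := fun i => \esum_(j in setT) ((A i j)%:E * v j).

Lemma mv_term_ge0 A v i j : nonneg_matrix A -> nneg_vec v ->
  0 <= (A i j)%:E * v j.
Proof. by move=> A0 v0; rewrite mule_ge0 ?lee_fin. Qed.

Lemma mv_ge0 A v : nonneg_matrix A -> nneg_vec v -> nneg_vec (mv A v).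
Proof. by move=> A0 v0 i; apply: esum_ge0 => j _; exact: mv_term_ge0. Qed.

Lemma le_mv A v w : nonneg_matrix A -> (forall i, v i <= w i) ->
  forall i, mv A v i <= mv A w i.
Proof.
move=> A0 vw i; apply: le_esum => j _; apply: lee_wpmul2l => //.
by rewrite lee_fin.
Qed.

Lemma transpose_ge0 A : nonneg_matrix A -> nonneg_matrix (transpose A).
Proof. by move=> A0 i j; exact: A0. Qed.

Lemma mv_adjoint A v w : nonneg_matrix A -> nneg_vec v -> nneg_vec w ->
  ip (mv A v) w = ip v (mv (transpose A) w).
Proof.
move=> A0 v0 w0; rewrite /ip /mv.
transitivity (\esum_(i in setT) \esum_(j in setT) ((A i j)%:E * v j * w i)).
  by apply: eq_esum => i _; rewrite -esumZr// => j; exact: mv_term_ge0.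
rewrite exchange_esum; last by move=> i j; rewrite mule_ge0 ?mv_term_ge0.
apply: eq_esum => j _; rewrite -esumZl//; last first.
  by move=> i; rewrite mule_ge0 ?lee_fin ?A0.
by apply: eq_esum => i _; rewrite muleAC muleC.
Qed.

Lemma mvZ A v c : nonneg_matrix A -> nneg_vec v -> 0 <= c ->
  mv A (fun i => c * v i) = fun i => c * mv A v i.
Proof.
move=> A0 v0 c0; apply/funext => i; rewrite /mv -esumZl//.
  by apply: eq_esum => j _; rewrite muleCA.
by move=> j; exact: mv_term_ge0.
Qed.

Lemma mv_esum (U : choiceType) A (v : U -> I -> \bar R) :
  nonneg_matrix A -> (forall n, nneg_vec (v n)) ->
  mv A (fun i => \esum_(n in setT) v n i) = fun i => \esum_(n in setT) mv A (v n) i.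
Proof.
move=> A0 v0; apply/funext => i; rewrite /mv exchange_esum; last first.
  by move=> n j; exact: mv_term_ge0.
apply: eq_esum => j _; rewrite esumZl ?lee_fin//.
by move=> n; exact: v0.
Qed.

Lemma mv_unit A i j : nonneg_matrix A -> mv A (unit_vec j) i = (A i j)%:E.
Proof.
move=> A0; rewrite /mv (@esum_delta _ _ _ j) /unit_vec ?eqxx ?mule1 ?lee_fin//.
by move=> k /negPf->; rewrite mule0.
Qed.

Lemma op_bound_transpose A c : nonneg_matrix A ->
  op_bound (mv A) c -> op_bound (mv (transpose A)) c.
Proof.
move=> A0 Ac; apply: op_bound_adjoint Ac _ _ => v.
  exact/mv_ge0/transpose_ge0.
by move=> w; exact: mv_adjoint.
Qed.

(* Otherwise pick [v k] in the unit ball with [|A (v k)|^2 >= 4^k k]; then [A] maps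
   [\sum_k 2^-k (v k)] to a vector of infinite norm. *)
Lemma nonneg_matrix_bounded A : nonneg_matrix A ->
  (forall v, nneg_vec v -> ip v v < +oo -> ip (mv A v) (mv A v) < +oo) ->
  exists c, op_bound (mv A) c.
Proof.
move=> A0 Afin; apply: contrapT => /forallNP noc.
have unb (c : R) : exists v, [/\ nneg_vec v, ip v v <= 1 & c%:E <= ip (mv A v) (mv A v)].
  (* The number [|c| + 1] is positive, as [op_bound] demands, and its square is at least [c]. *)
  have d0 : (0 < `|c| + 1)%R by rewrite ltr_wpDl.
  have : exists2 v, nneg_vec v & ((`|c| + 1) ^+ 2)%:E * ip v v < ip (mv A v) (mv A v).
    apply: contrapT => nov; apply: (noc (`|c| + 1)%R); split => //.
      by move=> v; exact: mv_ge0.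
    by move=> v v0; rewrite leNgt; apply/negP => vA; apply: nov; exists v.
  move=> [v v0 vA].
  have [vv0|vvn0] := eqVneq (ip v v) 0.
    have v_eq0 i : v i = 0.
      apply/eqP; rewrite eq_le v0 andbT; have := sqr_le_ip i v0; rewrite vv0.
      have := v0 i; case: (v i) => [r||]//; rewrite -EFinM !lee_fin => r0 rr.
      by rewrite leNgt; apply/negP => r1; have := mulr_gt0 r1 r1; rewrite ltNge rr.
    move: vA; rewrite vv0 mule0 ltNge => /negP[].
    rewrite [X in X <= _]esum1// => i _; rewrite [X in X * _]esum1 ?mul0e// => j _.
    by rewrite v_eq0 mule0.
  have [N N0 vvE] : exists2 N, (0 < N)%R & ip v v = N%:E.
    move: vA vvn0 (ip_ge0 v0 v0); case: (ip v v) => [N _||]//; last first.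
      by rewrite gt0_muley ?lte_fin ?exprn_gt0// ltNge leey.
    by rewrite eqe lee_fin => N0 N1; exists N; rewrite // lt0r N0.
  (* Scaling by [a] normalises [v] to norm 1. *)
  pose a := (Num.sqrt N)^-1%R; have a0 : (0 <= a)%R by rewrite invr_ge0 sqrtr_ge0.
  have aa : (a * a = N^-1)%R by rewrite -invfM -expr2 sqr_sqrtr// ltW.
  have ipa w : nneg_vec w -> ip (fun i => a%:E * w i) (fun i => a%:E * w i) = (N^-1)%:E * ip w w.
    move=> w0; rewrite -esumZl ?lee_fin ?invr_ge0 ?(ltW N0)//.
      by apply: eq_esum => i _; rewrite muleACA -EFinM aa.
    by move=> i; rewrite mule_ge0.
  exists (fun i => a%:E * v i); split.
  - by move=> i; rewrite mule_ge0 ?lee_fin.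
  - by rewrite ipa// vvE -EFinM mulVf// gt_eqF.
  - rewrite mvZ ?lee_fin// ipa; last exact: mv_ge0.
    apply: (@le_trans _ _ ((N^-1)%:E * (((`|c| + 1) ^+ 2)%:E * ip v v))); last first.
      by apply: lee_wpmul2l; rewrite ?lee_fin ?invr_ge0 ltW.
    rewrite vvE -!EFinM lee_fin mulrCA mulVf ?mulr1 ?gt_eqF//.
    by apply: le_trans (ler_norm _) _; have := normr_ge0 c; nra.
have [v vP] := choice (fun k : nat => unb (4 ^+ k * k%:R)%R).
have v0 n : nneg_vec (v n) by have [] := vP n.
have h0 n : (0 <= 2^-1 ^+ n :> R)%R by rewrite exprn_ge0// invr_ge0.
have hv0 n : nneg_vec (fun i => (2^-1 ^+ n)%:E * v n i).
  by move=> i; rewrite mule_ge0 ?lee_fin// v0.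
pose u i := \esum_(n in setT) ((2^-1 ^+ n)%:E * v n i).
have u0 : nneg_vec u by move=> i; apply: esum_ge0 => n _; exact: hv0.
have geo : \esum_(n in [set: nat]) (2^-1 ^+ n : R)%:E < +oo.
  by apply: le_lt_trans (esum_geometric _) _; [lra|exact: ltry].
have : ip u u < +oo.
  apply: le_lt_trans (ip_weighted_sum h0 v0) _.
  have s0 : 0 <= \esum_(n in [set: nat]) (2^-1 ^+ n : R)%:E.
    by apply: esum_ge0 => n _; rewrite lee_fin.
  apply: lte_mul_pinfty; rewrite ?ge0_fin_numE//.
  apply: le_lt_trans geo; apply: le_esum => n _.
  rewrite -[leRHS]mule1; apply: lee_wpmul2l; rewrite ?lee_fin//.
  by have [] := vP n.
move=> /(Afin _ u0).
case E : (ip (mv A u) (mv A u)) => [N||]//; last first.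
  by have := ip_ge0 (mv_ge0 A0 u0) (mv_ge0 A0 u0); rewrite E.
(* A single term suffices: [|A u|^2 >= 4^-k |A (v k)|^2 >= k > N]. *)
move=> _; pose k := (Num.trunc N).+1.
have : (N < k%:R)%R by exact: truncnS_gt.
apply/negP; rewrite -leNgt -lee_fin -E.
have mvk i : (2^-1 ^+ k)%:E * mv A (v k) i <= mv A u i.
  rewrite mv_esum//; apply: le_trans (@le_esum_term _ _ _ k _) => [|n].
    by rewrite mvZ ?lee_fin.
  exact: mv_ge0.
have kv0 : nneg_vec (fun i => (2^-1 ^+ k)%:E * mv A (v k) i).
  by move=> i; rewrite mule_ge0 ?lee_fin// mv_ge0.
apply: le_trans (le_ip kv0 kv0 mvk mvk).
have -> : ip (fun i => (2^-1 ^+ k)%:E * mv A (v k) i) (fun i => (2^-1 ^+ k)%:E * mv A (v k) i) =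
    (4 ^- k)%:E * ip (mv A (v k)) (mv A (v k)).
  rewrite -esumZl ?lee_fin ?invr_ge0 ?exprn_ge0//; last first.
    by move=> i; rewrite mule_ge0 ?mv_ge0.
  apply: eq_esum => i _; rewrite muleACA -EFinM -exprMn -exprVn.
  by rewrite (_ : (2^-1 * 2^-1 = 4^-1 :> R)%R)//; lra.
have [_ _ kA] := vP k.
apply: (@le_trans _ _ ((4 ^- k)%:E * (4 ^+ k * k%:R)%:E)).
  by rewrite -EFinM lee_fin mulKf// expf_neq0.
by apply: lee_wpmul2l; rewrite ?lee_fin ?invr_ge0 ?exprn_ge0.
Qed.

End PositiveMatrices.

(** * Neumann series of a non-negative matrix *)

Section PositiveNeumannSeries.
Local Open Scope ereal_scope.
Context {R : realType} {I : countType}.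
Variable B : I -> I -> R.
Hypothesis B0 : nonneg_matrix B.
Implicit Types (v w x : I -> \bar R) (s t : R).

(** The series of the resolvent [(t - B)^-1]; as an extended sum it needs no convergence
    condition. *)
Definition neumann t x : I -> \bar R :=
  fun i => \esum_(n in setT) ((t^-1 ^+ n.+1)%:E * iter n (mv B) x i).

Lemma iter_mv_ge0 n x : nneg_vec x -> nneg_vec (iter n (mv B) x).
Proof. by move=> x0; elim: n => //= n; exact: mv_ge0. Qed.

Lemma le_iter_mv n v w : (forall i, v i <= w i) ->
  forall i, iter n (mv B) v i <= iter n (mv B) w i.
Proof. by move=> vw; elim: n => //= n IH; exact: le_mv. Qed.

Lemma iter_mvZ n x (c : \bar R) : nneg_vec x -> 0 <= c ->
  iter n (mv B) (fun i => c * x i) = fun i => c * iter n (mv B) x i.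
Proof.
by move=> x0 c0; elim: n => //= n ->; rewrite mvZ//; exact: iter_mv_ge0.
Qed.

Lemma neumann_term_ge0 t x n i : (0 < t)%R -> nneg_vec x ->
  0 <= (t^-1 ^+ n.+1)%:E * iter n (mv B) x i.
Proof.
move=> t0 x0; rewrite mule_ge0 ?iter_mv_ge0// lee_fin exprn_ge0// invr_ge0.
exact: ltW.
Qed.

Lemma neumann_ge0 t x : (0 < t)%R -> nneg_vec x -> nneg_vec (neumann t x).
Proof. by move=> t0 x0 i; apply: esum_ge0 => n _; exact: neumann_term_ge0. Qed.

Lemma ge_neumann_term n t x i : (0 < t)%R -> nneg_vec x ->
  (t^-1 ^+ n.+1)%:E * iter n (mv B) x i <= neumann t x i.
Proof.
move=> t0 x0; apply: (@le_esum_term _ _ (fun n => (t^-1 ^+ n.+1)%:E * iter n (mv B) x i)).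
by move=> k; exact: neumann_term_ge0.
Qed.

Lemma mv_neumann t x : (0 < t)%R -> nneg_vec x ->
  mv B (neumann t x) = fun i => \esum_(n in setT) ((t^-1 ^+ n.+1)%:E * iter n.+1 (mv B) x i).
Proof.
move=> t0 x0; rewrite mv_esum//; last by move=> n i; exact: neumann_term_ge0.
apply/funext => i; apply: eq_esum => n _; rewrite mvZ//; first exact: iter_mv_ge0.
by rewrite lee_fin exprn_ge0// invr_ge0 ltW.
Qed.

(** The resolvent equation [(t - B) G x = x], written without a difference that could be
    [+oo - +oo]. Multiplication by [t] splits off the term of index 0. *)
Lemma neumann_eq t x i : (0 < t)%R -> nneg_vec x ->
  t%:E * neumann t x i = x i + mv B (neumann t x) i.
Proof.
move=> t0 x0; rewrite mv_neumann// -esumZl ?lee_fin ?ltW//; last first.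
  by move=> n; exact: neumann_term_ge0.
rewrite esum_nat_recl; last first.
  by move=> n; rewrite mule_ge0 ?neumann_term_ge0// lee_fin ltW.
rewrite expr1 muleA -EFinM divff ?gt_eqF// mul1e; congr (_ + _).
apply: eq_esum => n _; rewrite muleA -EFinM.
by rewrite (exprS _ n.+1) mulVKf// gt_eqF.
Qed.

Lemma ip_scale (c : R) v : nneg_vec v ->
  ip (fun i => c%:E * v i) (fun i => c%:E * v i) = (c ^+ 2)%:E * ip v v.
Proof.
move=> v0; rewrite -esumZl ?lee_fin ?sqr_ge0//.
  by apply: eq_esum => i _; rewrite muleACA -EFinM.
by move=> i; rewrite mule_ge0.
Qed.

(** With [q = s / t] the series is [\sum_n q^n v_n], where [v_n = t^-1 s^-n B^n x] has norm at most
    [C / t] times that of [x]. Both sums in [ip_weighted_sum] are then geometric. *)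
Lemma neumann_bound s t : (s < t)%R -> power_bound (mv B) s ->
  exists K : R, op_bound (neumann t) K.
Proof.
move=> st [s0 [C TC]]; have t0 := lt_trans s0 st.
have [C0 _ _] := TC 0%N; rewrite expr0 mulr1 in C0.
pose q := (s / t)%R; have q0 : (0 < q)%R by rewrite divr_gt0.
have q1 : (q < 1)%R by rewrite ltr_pdivrMr ?mul1r.
have p0 : (0 < (1 - q)^-1)%R by rewrite invr_gt0 subr_gt0.
exists ((1 - q)^-1 * (C / t))%R; split.
- by rewrite mulr_gt0// divr_gt0.
- by move=> v; exact: neumann_ge0.
move=> x x0.
pose v n i := (t^-1 * s^-1 ^+ n)%:E * iter n (mv B) x i.
have ts n : (0 <= t^-1 * s^-1 ^+ n)%R.
  by rewrite mulr_ge0 ?exprn_ge0 ?invr_ge0 ?ltW.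
have v0 n : nneg_vec (v n) by move=> i; rewrite mule_ge0 ?lee_fin// iter_mv_ge0.
have qn0 n : (0 <= q ^+ n)%R by rewrite exprn_ge0 ?ltW.
have := ip_weighted_sum qn0 v0.
rewrite (_ : (fun i => _) = neumann t x); last first.
  apply/funext => i; apply: eq_esum => n _; rewrite /v muleA -EFinM; congr (_%:E * _).
  by rewrite expr_div_n exprS !exprVn; field; rewrite !gt_eqF// exprn_gt0.
have vb n : ip (v n) (v n) <= ((C / t) ^+ 2)%:E * ip x x.
  rewrite ip_scale; last exact: iter_mv_ge0.
  have [_ _ /(_ _ x0) TCx] := TC n.
  apply: (@le_trans _ _ (((t^-1 * s^-1 ^+ n) ^+ 2)%:E * (((C * s ^+ n) ^+ 2)%:E * ip x x))).
    by apply: lee_wpmul2l; rewrite ?lee_fin ?sqr_ge0.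
  rewrite muleA -EFinM -exprMn (_ : (t^-1 * s^-1 ^+ n * (C * s ^+ n) = C / t)%R)//.
  by rewrite exprVn; field; rewrite !gt_eqF// exprn_gt0.
move=> /le_trans; apply.
have geo : \esum_(n in [set: nat]) (q ^+ n)%:E <= ((1 - q)^-1)%:E.
  by apply: esum_geometric; rewrite ltW.
have geo0 : 0 <= \esum_(n in [set: nat]) (q ^+ n)%:E.
  by apply: esum_ge0 => n _; rewrite lee_fin.
apply: (@le_trans _ _ (((1 - q)^-1)%:E * (((1 - q)^-1)%:E * (((C / t) ^+ 2)%:E * ip x x)))).
  apply: lee_pmul => //.
    by apply: esum_ge0 => n _; rewrite mule_ge0 ?lee_fin// ip_ge0.
  apply: (@le_trans _ _ ((\esum_(n in [set: nat]) (q ^+ n)%:E) * (((C / t) ^+ 2)%:E * ip x x))).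
    rewrite -esumZr; last 2 first.
    - by rewrite mule_ge0 ?lee_fin ?sqr_ge0// ip_ge0.
    - by move=> n; rewrite lee_fin.
    by apply: le_esum => n _; apply: lee_wpmul2l; rewrite ?lee_fin.
  by apply: lee_wpmul2r => //; rewrite mule_ge0 ?lee_fin ?sqr_ge0// ip_ge0.
rewrite [leLHS]muleA [leLHS]muleA -!EFinM (_ : (_ * _ * _ = ((1 - q)^-1 * (C / t)) ^+ 2)%R)//.
by rewrite [RHS]exprMn.
Qed.

(** The square of the series is the sum of the [t^-(k+l+2) B^(k+l)]; the [n + 1] pairs with
    [k + l = n] give the left-hand side. *)
Lemma neumann_sqr_ge n t x i : (0 < t)%R -> nneg_vec x ->
  (n.+1%:R * t^-1 ^+ n.+2)%:E * iter n (mv B) x i <= neumann t (neumann t x) i.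
Proof.
move=> t0 x0; have tn0 k : (0 <= t^-1 ^+ k)%R by rewrite exprn_ge0 ?invr_ge0 ?ltW.
pose f k := (t^-1 ^+ k.+1)%:E * iter k (mv B) (neumann t x) i.
have nx0 := neumann_ge0 t0 x0.
apply: (@le_trans _ _ (\sum_(k < n.+1) f k)); last first.
  by apply: esum_nat_ge_sum => k; exact: neumann_term_ge0.
apply: (@le_trans _ _ (\sum_(k < n.+1) (t^-1 ^+ n.+2)%:E * iter n (mv B) x i)).
  have -> (c : \bar R) m : \sum_(i < m) c = m%:R%:E * c.
    elim: m => [|m IH]; first by rewrite big_ord0 mul0e.
    by rewrite big_ord_recr/= IH -natr1 EFinD ge0_muleDl ?lee_fin// mul1e.
  by rewrite EFinM -muleA.
apply: lee_sum => k _.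
have kn : (k <= n)%N by rewrite -ltnS.
apply: (@le_trans _ _ ((t^-1 ^+ k.+1)%:E * iter k (mv B)
    (fun i => (t^-1 ^+ (n - k).+1)%:E * iter (n - k) (mv B) x i) i)).
  rewrite iter_mvZ ?lee_fin//; last exact: iter_mv_ge0.
  by rewrite -iterD subnKC// muleA -EFinM -exprD addSn addnS subnKC.
apply: lee_wpmul2l; rewrite ?lee_fin//; apply: le_iter_mv => j.
exact: ge_neumann_term.
Qed.

(* Since [(n + 1) t^-(n+2) B^n <= (neumann t)^2], a bound on [neumann t] that is
   uniform in [t > t0] makes some power of [B / t0] a strict contraction. *)
Lemma power_bound_improve (t0 M d : R) : (0 < t0)%R -> (0 < d)%R ->
  (exists b, op_bound (mv B) b) ->
  (forall t, t0 < t < t0 + d -> op_bound (neumann t) M)%R ->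
  exists2 s, (s < t0)%R & power_bound (mv B) s.
Proof.
move=> t00 d0 [b Bb] GM.
(* Since [t <= 2 * t0] below, this choice gives [M ^+ 2 <= (N + 1) / (2 * t ^+ 2)]. *)
pose N := (Num.trunc (2 * (M ^+ 2 * (2 * t0) ^+ 2))).+1.
have NM : (2 * (M ^+ 2 * (2 * t0) ^+ 2) < N%:R)%R by exact: truncnS_gt.
have Np : (0 < N)%N by []; have NR : (1 <= N%:R :> R)%R by rewrite ler1n.
move: N NM Np NR => N NM Np NR.
have N0 : (0 < N%:R :> R)%R by rewrite ltr0n.
(* The first bound keeps [t0 + e] in the range of the hypothesis. The second gives [2 * e <= h * t0]
   for [h = 1 / (2 * N)], whence [(1 - h) * (t0 + e) < t0]. *)
pose e := Num.min (d / 2)%R (t0 / (4 * N%:R))%R.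
have e0 : (0 < e)%R by rewrite lt_min !divr_gt0// mulr_gt0.
have ed : (e < d)%R by rewrite (@le_lt_trans _ _ (d / 2)%R)// ?ge_min ?lexx//; lra.
have eN : (e * (4 * N%:R) <= t0)%R.
  by rewrite -ler_pdivlMr ?mulr_gt0// ge_min lexx orbT.
pose t := (t0 + e)%R; pose h : R := ((2 * N%:R)^-1)%R.
have hN : (N%:R * h = 1 / 2)%R by rewrite /h; field; rewrite gt_eqF.
have h0 : (0 < h)%R by rewrite invr_gt0 mulr_gt0.
have h1 : (h <= 1 / 2)%R by nra.
have tp : (0 < t)%R by rewrite addr_gt0.
have t2 : (t <= 2 * t0)%R by rewrite /t; nra.
have [M0 _ GMt] : op_bound (neumann t) M by apply: GM; rewrite /t; apply/andP; split; lra.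
exists ((1 - h) * t)%R.
  rewrite /t.
  have : (e * (4 * N%:R) * h = 2 * e)%R by rewrite /h; field; rewrite gt_eqF.
  have : (e * (4 * N%:R) * h <= t0 * h)%R by rewrite ler_wpM2r// ltW.
  nra.
have s0 : (0 < (1 - h) * t)%R by rewrite mulr_gt0//; lra.
apply: (power_bound_root Np s0 Bb); split; first by rewrite exprn_gt0.
  by move=> v; exact: iter_mv_ge0.
move=> x x0.
have nx0 := neumann_ge0 tp x0.
pose c : R := (N.+1%:R * t^-1 ^+ N.+2)%R.
have tN0 : (0 < t ^+ N.+2)%R by rewrite exprn_gt0.
have c0 : (0 < c)%R by rewrite mulr_gt0 ?ltr0n// exprn_gt0// invr_gt0.
have Nx0 := iter_mv_ge0 N x0.
have cx0 : nneg_vec (fun i => c%:E * iter N (mv B) x i).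
  by move=> i; rewrite mule_ge0// lee_fin ltW.
have cN i : c%:E * iter N (mv B) x i <= neumann t (neumann t x) i.
  exact: neumann_sqr_ge.
have := le_ip cx0 cx0 cN cN; rewrite ip_scale// => cip.
have {}cip : (c ^+ 2)%:E * ip (iter N (mv B) x) (iter N (mv B) x) <=
    (M ^+ 2 * M ^+ 2)%:E * ip x x.
  apply: le_trans cip _; apply: le_trans (GMt _ nx0) _.
  rewrite (EFinM (M ^+ 2)) -(muleA (M ^+ 2)%:E).
  by apply: lee_wpmul2l; [rewrite lee_fin sqr_ge0|exact: GMt].
apply: (@le_trans _ _ ((c^-1 ^+ 2)%:E * ((c ^+ 2)%:E * ip (iter N (mv B) x) (iter N (mv B) x)))).
  by rewrite muleA -EFinM -exprMn mulVf ?gt_eqF// expr1n mul1e.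
apply: le_trans (lee_wpmul2l _ cip) _; first by rewrite lee_fin sqr_ge0.
rewrite muleA -EFinM; apply: lee_wpmul2r; first exact: ip_ge0.
rewrite lee_fin -!exprMn mulrC lerXn2r
  ?nnegrE ?mulr_ge0 ?exprn_ge0 ?invr_ge0 ?(ltW c0) ?(ltW M0) ?(ltW s0)//.
rewrite ler_pdivrMr// exprMn.
(* Hence the norm of [B^N] is at most [M^2 / c <= t^N / 2 <= ((1 - h) t)^N]. *)
have bern : (1 / 2 <= (1 - h) ^+ N)%R.
  have : (1 + N%:R * - h <= (1 - h) ^+ N)%R by apply: bernoulli; lra.
  by rewrite mulrN hN; lra.
apply: (@le_trans _ _ (1 / 2 * t ^+ N * c)%R); last first.
  by rewrite ler_wpM2r ?(ltW c0)// ler_wpM2r// exprn_ge0// ltW.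
have -> : (1 / 2 * t ^+ N * c = 1 / 2 * N.+1%:R / t ^+ 2)%R.
  by rewrite /c exprVn (exprD _ 2 N); field; rewrite !gt_eqF// exprn_gt0.
rewrite ler_pdivlMr ?exprn_gt0// -(natr1 N).
have : (t ^+ 2 <= (2 * t0) ^+ 2)%R by rewrite lerXn2r// nnegrE; lra.
move=> tt; have : (M ^+ 2 * t ^+ 2 <= M ^+ 2 * (2 * t0) ^+ 2)%R.
  by rewrite ler_wpM2l// sqr_ge0.
lra.
Qed.

End PositiveNeumannSeries.

(** * Complex sums *)

Section RealSums.
Context {R : realType}.
Implicit Types I J : countType.

Definition rsummable I (f : I -> R) := (\esum_(i in setT) `|f i|%:E < +oo)%E.

Let rp I (f : I -> R) i := Num.max (f i) 0.
Let rn I (f : I -> R) i := Num.max (- f i) 0.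

Let rp_ge0 I (f : I -> R) i : 0 <= rp f i. Proof. by rewrite le_max lexx orbT. Qed.
Let rn_ge0 I (f : I -> R) i : 0 <= rn f i. Proof. by rewrite le_max lexx orbT. Qed.

Let rp_le I (f : I -> R) i : rp f i <= `|f i|.
Proof. by rewrite ge_max ler_norm normr_ge0. Qed.

Let rn_le I (f : I -> R) i : rn f i <= `|f i|.
Proof. by rewrite ge_max -normrN ler_norm normr_ge0. Qed.

Let rpBrn I (f : I -> R) i : f i = rp f i - rn f i.
Proof. by rewrite /rp /rn; case: (leP (f i) 0); case: (leP (- f i) 0); lra. Qed.

(** Any decomposition into non-negative summable families is allowed, not only the one into positive
    and negative parts. This reduces the linearity of [rsum] to that of extended sums. *)
Lemma rsumE I (p q : I -> R) : (forall i, 0 <= p i) -> (forall i, 0 <= q i) ->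
  (\esum_(i in setT) (p i)%:E < +oo)%E -> (\esum_(i in setT) (q i)%:E < +oo)%E ->
  rsum (fun i => p i - q i) =
  fine (\esum_(i in setT) (p i)%:E) - fine (\esum_(i in setT) (q i)%:E).
Proof.
move=> p0 q0 ps qs; rewrite /rsum.
have fins (h : I -> R) : (forall i, 0 <= h i) ->
    (\esum_(i in setT) (h i)%:E < +oo)%E -> summable [set: I] (EFin \o h).
  move=> h0; apply: le_lt_trans; apply: le_esum => i _.
  by rewrite /= ger0_norm.
rewrite (_ : EFin \o _ = (EFin \o p) \- (EFin \o q))%E; last first.
  by apply/funext => i /=; rewrite EFinB.
rewrite esumB ?fineB//; try by [exact: fins | move=> i _; rewrite lee_fin].
  by rewrite ge0_fin_numE// esum_ge0// => i _; rewrite lee_fin.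
by rewrite ge0_fin_numE// esum_ge0// => i _; rewrite lee_fin.
Qed.

Lemma esum_fin_num I (p q : I -> R) : rsummable q -> (forall i, 0 <= p i <= `|q i|) ->
  (\esum_(i in setT) (p i)%:E)%E \is a fin_num.
Proof.
move=> qs pq; rewrite ge0_fin_numE; last first.
  by apply: esum_ge0 => i _; rewrite lee_fin; case/andP: (pq i).
apply: le_lt_trans qs; apply: le_esum => i _; rewrite lee_fin.
by case/andP: (pq i).
Qed.

Let rp_fin I (f : I -> R) : rsummable f -> (\esum_(i in setT) (rp f i)%:E)%E \is a fin_num.
Proof. by move=> fs; apply: esum_fin_num fs _ => i; rewrite rp_ge0 rp_le. Qed.

Let rn_fin I (f : I -> R) : rsummable f -> (\esum_(i in setT) (rn f i)%:E)%E \is a fin_num.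
Proof. by move=> fs; apply: esum_fin_num fs _ => i; rewrite rn_ge0 rn_le. Qed.

Let fin_lt (x : \bar R) : x \is a fin_num -> (x < +oo)%E.
Proof. by rewrite fin_numElt => /andP[]. Qed.

Let rsum_pn I (f : I -> R) : rsummable f ->
  rsum f = fine (\esum_(i in setT) (rp f i)%:E) - fine (\esum_(i in setT) (rn f i)%:E).
Proof.
move=> fs; rewrite -rsumE//; try by apply/fin_lt; [exact: rp_fin | exact: rn_fin].
- by congr rsum; apply/funext => i; exact: rpBrn.
- exact/fin_lt/rp_fin.
- exact/fin_lt/rn_fin.
Qed.

Lemma ge0_rsum I (f : I -> R) : (forall i, 0 <= f i) ->
  rsum f = fine (\esum_(i in setT) (f i)%:E).
Proof.
move=> f0; rewrite /rsum.
have -> : (\esum_(i in setT) (EFin \o f)^\- i = 0)%E.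
  by rewrite esum1// => i _; rewrite funenegE/= max_r// lee_fin oppr_le0.
rewrite sube0; congr fine; apply: eq_esum => i _.
by rewrite funeposE/= max_l// lee_fin.
Qed.

Lemma rsumN I (f : I -> R) : rsummable f -> rsum (fun i => - f i) = - rsum f.
Proof.
move=> fs; rewrite (rsum_pn fs) opprB -rsumE//.
- by congr rsum; apply/funext => i; rewrite [in LHS]rpBrn opprB.
- exact/fin_lt/rn_fin.
- exact/fin_lt/rp_fin.
Qed.

Lemma rsumD I (f g : I -> R) : rsummable f -> rsummable g ->
  rsum (fun i => f i + g i) = rsum f + rsum g.
Proof.
move=> fs gs; rewrite (rsum_pn fs) (rsum_pn gs) addrACA -opprD.
have add (p q : I -> R) : (forall i, 0 <= p i) -> (forall i, 0 <= q i) ->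
    (\esum_(i in setT) (p i)%:E)%E \is a fin_num -> (\esum_(i in setT) (q i)%:E)%E \is a fin_num ->
    fine (\esum_(i in setT) (p i)%:E) + fine (\esum_(i in setT) (q i)%:E) =
    fine (\esum_(i in setT) (p i + q i)%:E) /\ (\esum_(i in setT) (p i + q i)%:E < +oo)%E.
  move=> p0 q0 pf qf.
  have -> : (\esum_(i in setT) (p i + q i)%:E =
      \esum_(i in setT) (p i)%:E + \esum_(i in setT) (q i)%:E)%E.
    by rewrite -esumD// => i _; rewrite lee_fin.
  by rewrite fineD//; split=> //; apply/fin_lt; rewrite fin_numD pf qf.
have [-> pf] := add _ _ (rp_ge0 f) (rp_ge0 g) (rp_fin fs) (rp_fin gs).
have [-> nf] := add _ _ (rn_ge0 f) (rn_ge0 g) (rn_fin fs) (rn_fin gs).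
rewrite -rsumE// => [|i|i]; rewrite ?addr_ge0//.
by congr rsum; apply/funext => i; rewrite [in LHS](rpBrn f) [in LHS](rpBrn g) opprD addrACA.
Qed.

Lemma rsummableN I (f : I -> R) : rsummable f -> rsummable (fun i => - f i).
Proof. by apply: le_lt_trans; apply: le_esum => i _; rewrite normrN. Qed.

Lemma rsummableZ I (c : R) (f : I -> R) : rsummable f -> rsummable (fun i => c * f i).
Proof.
move=> fs; rewrite /rsummable.
rewrite (eq_esum (b := fun i => (`|c|%:E * `|f i|%:E)%E)); last first.
  by move=> i _; rewrite normrM.
rewrite esumZl//; apply: lte_mul_pinfty => //.
Qed.

Lemma rsumZ I (c : R) (f : I -> R) : rsummable f ->
  rsum (fun i => c * f i) = c * rsum f.
Proof.
wlog c0 : c / 0 <= c => [wl fs|fs].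
  have [/wl->//|c0] := leP 0 c.
  have -> : (fun i => c * f i) = (fun i => - (- c * f i)).
    by apply/funext => i; rewrite mulNr opprK.
  by rewrite rsumN ?wl ?mulNr ?opprK// ?oppr_ge0 ?ltW//; exact: rsummableZ.
rewrite (rsum_pn fs) mulrBr.
have scale (p : I -> R) : (forall i, 0 <= p i) -> (\esum_(i in setT) (p i)%:E)%E \is a fin_num ->
    c * fine (\esum_(i in setT) (p i)%:E) = fine (\esum_(i in setT) (c * p i)%:E) /\
    (\esum_(i in setT) (c * p i)%:E < +oo)%E.
  move=> p0 pf; have -> : (\esum_(i in setT) (c * p i)%:E = c%:E * \esum_(i in setT) (p i)%:E)%E.
    by rewrite -esumZl.
  by rewrite fineM//; split=> //; apply/fin_lt; rewrite fin_numM.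
have [-> pf] := scale _ (rp_ge0 f) (rp_fin fs).
have [-> nf] := scale _ (rn_ge0 f) (rn_fin fs).
rewrite -rsumE// => [|i|i]; rewrite ?mulr_ge0//.
by congr rsum; apply/funext => i; rewrite [in LHS](rpBrn f) mulrBr.
Qed.

Lemma ler_rsum I (f g : I -> R) : rsummable f -> rsummable g ->
  (forall i, f i <= g i) -> rsum f <= rsum g.
Proof.
move=> fs gs fg; rewrite -subr_ge0 -rsumN// -rsumD//; last exact: rsummableN.
rewrite ge0_rsum; last by move=> i; rewrite subr_ge0.
by apply/fine_ge0/esum_ge0 => i _; rewrite lee_fin subr_ge0.
Qed.

(** Fubini: [exchange_esum] is applied to the positive and the negative parts, whose double sums are
    finite. *)
Lemma exchange_rsum I J (f : I -> J -> R) :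
  (\esum_(i in setT) \esum_(j in setT) `|f i j|%:E < +oo)%E ->
  rsum (fun i => rsum (f i)) = rsum (fun j => rsum (f^~ j)).
Proof.
move=> fs.
have dbl (U V : countType) (p : U -> V -> R) (g : U -> V -> R) :
    (\esum_(i in setT) \esum_(j in setT) `|g i j|%:E < +oo)%E ->
    (forall i j, 0 <= p i j <= `|g i j|) ->
    [/\ forall i, rsummable (g i),
     forall i, (\esum_(j in setT) (p i j)%:E)%E = (fine (\esum_(j in setT) (p i j)%:E))%:E
     & (\esum_(i in setT) \esum_(j in setT) (p i j)%:E < +oo)%E].
  move=> gs pg.
  have gis i : rsummable (g i).
    apply: le_lt_trans gs.
    apply: (@le_esum_term _ _ (fun i => \esum_(j in setT) `|g i j|%:E)%E) => k.
    by apply: esum_ge0 => j _; rewrite lee_fin.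
  split=> // [i|].
    by rewrite fineK//; apply: esum_fin_num (gis i) _.
  apply: le_lt_trans gs; apply: le_esum => i _; apply: le_esum => j _.
  by rewrite lee_fin; case/andP: (pg i j).
have both (U V : countType) (g : U -> V -> R) :
    (\esum_(i in setT) \esum_(j in setT) `|g i j|%:E < +oo)%E ->
    rsum (fun i => rsum (g i)) =
    fine (\esum_(i in setT) \esum_(j in setT) (rp (g i) j)%:E)%E -
    fine (\esum_(i in setT) \esum_(j in setT) (rn (g i) j)%:E)%E.
  move=> gs.
  have [i1 p1 s1] := dbl _ _ (fun i => rp (g i)) g gs
    (fun i j => introT andP (conj (rp_ge0 (g i) j) (rp_le (g i) j))).
  have [_ p2 s2] := dbl _ _ (fun i => rn (g i)) g gs
    (fun i j => introT andP (conj (rn_ge0 (g i) j) (rn_le (g i) j))).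
  have -> : (fun i => rsum (g i)) = (fun i => fine (\esum_(j in setT) (rp (g i) j)%:E)
       - fine (\esum_(j in setT) (rn (g i) j)%:E)).
    by apply/funext => i; rewrite -rsum_pn.
  rewrite rsumE.
  - by congr (fine _ - fine _); apply: eq_esum => i _; rewrite -?p1 -?p2.
  - by move=> i; apply/fine_ge0/esum_ge0 => j _; rewrite lee_fin.
  - by move=> i; apply/fine_ge0/esum_ge0 => j _; rewrite lee_fin.
  - by rewrite (eq_esum (fun i _ => esym (p1 i))).
  - by rewrite (eq_esum (fun i _ => esym (p2 i))).
rewrite both// both; last by rewrite -exchange_esum// => i j; rewrite lee_fin.
by congr (fine _ - fine _); rewrite exchange_esum// => i j; rewrite lee_fin.
Qed.

Lemma rsum_recl (f : nat -> R) : rsummable f ->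
  rsum f = f 0%N + rsum (fun n => f n.+1).
Proof.
move=> fs; have fs' : rsummable (fun n => f n.+1).
  by apply: le_lt_trans fs; rewrite [leRHS]esum_nat_recl// leeDr.
rewrite (rsum_pn fs) (rsum_pn fs').
have recl (p : nat -> R) : (forall i, 0 <= p i) ->
    (\esum_(i in setT) (p i)%:E = (p 0%N)%:E + \esum_(i in setT) (p i.+1)%:E)%E.
  by move=> p0; rewrite esum_nat_recl// => i; rewrite lee_fin.
rewrite (recl _ (rp_ge0 f)) (recl _ (rn_ge0 f)).
have pf := rp_fin fs'; have nf := rn_fin fs'.
rewrite !fineD//= [f 0%N in RHS]rpBrn; lra.
Qed.

End RealSums.

Section ComplexSums.
Context {R : realType}.
Implicit Types I J : countType.
Notation normc := (@Normc.normc R).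
Notation Re := complex.Re.
Notation Im := complex.Im.

Lemma normc_ge0 (z : R[i]) : 0 <= normc z.
Proof. by case: z => a b; exact: sqrtr_ge0. Qed.

Lemma sqr_normc (z : R[i]) : normc z ^+ 2 = Re z ^+ 2 + Im z ^+ 2.
Proof. by case: z => a b /=; rewrite sqr_sqrtr// addr_ge0// sqr_ge0. Qed.

Lemma normr_Re_le (z : R[i]) : `|Re z| <= normc z.
Proof.
rewrite -(@ler_pXn2r _ 2) ?nnegrE ?normc_ge0// sqr_normc real_normK ?num_real//.
by rewrite lerDl sqr_ge0.
Qed.

Lemma normr_Im_le (z : R[i]) : `|Im z| <= normc z.
Proof.
rewrite -(@ler_pXn2r _ 2) ?nnegrE ?normc_ge0// sqr_normc real_normK ?num_real//.
by rewrite lerDr sqr_ge0.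
Qed.

Lemma normc_real (a : R) : normc a%:C = `|a|.
Proof. by rewrite /= expr0n/= addr0 sqrtr_sqr. Qed.

Lemma ReM (a z : R[i]) : Re (a * z) = Re a * Re z - Im a * Im z.
Proof. by case: a z => [? ?] [? ?]. Qed.

Lemma ImM (a z : R[i]) : Im (a * z) = Re a * Im z + Im a * Re z.
Proof. by case: a z => [? ?] [? ?]. Qed.

Lemma eq_Re_Im (a z : R[i]) : Re a = Re z -> Im a = Im z -> a = z.
Proof. by case: a z => [? ?] [? ?] /= -> ->. Qed.

Lemma csummable_Re I (f : I -> R[i]) : csummable f -> rsummable (fun i => Re (f i)).
Proof.
by apply: le_lt_trans; apply: le_esum => i _; rewrite lee_fin normr_Re_le.
Qed.

Lemma csummable_Im I (f : I -> R[i]) : csummable f -> rsummable (fun i => Im (f i)).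
Proof.
by apply: le_lt_trans; apply: le_esum => i _; rewrite lee_fin normr_Im_le.
Qed.

Lemma csummableZ I (a : R[i]) (f : I -> R[i]) : csummable f ->
  csummable (fun i => a * f i).
Proof.
move=> fs; rewrite /csummable.
rewrite (eq_esum (b := fun i => ((normc a)%:E * (normc (f i))%:E)%E)); last first.
  by move=> i _; rewrite Normc.normcM.
rewrite esumZl ?lee_fin ?normc_ge0//; last by move=> i; rewrite lee_fin normc_ge0.
apply: lte_mul_pinfty => //; by rewrite lee_fin normc_ge0.
Qed.

Lemma csumD I (f g : I -> R[i]) : csummable f -> csummable g ->
  csum (fun i => f i + g i) = csum f + csum g.
Proof.
move=> fs gs; rewrite /csum; apply: eq_Re_Im => /=.
- rewrite -rsumD; [|exact: csummable_Re..].
  by congr rsum; apply/funext => i; rewrite raddfD.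
- rewrite -rsumD; [|exact: csummable_Im..].
  by congr rsum; apply/funext => i; rewrite raddfD.
Qed.

Lemma csumZ I (a : R[i]) (f : I -> R[i]) : csummable f ->
  csum (fun i => a * f i) = a * csum f.
Proof.
move=> fs; have fR := csummable_Re fs; have fI := csummable_Im fs.
apply: eq_Re_Im; rewrite ?ReM ?ImM/=.
- rewrite -!rsumZ// -rsumN; last exact: rsummableZ.
  rewrite -rsumD; [|exact: rsummableZ|exact/rsummableN/rsummableZ].
  by congr rsum; apply/funext => i; rewrite ReM.
- rewrite -!rsumZ// -rsumD; [|exact: rsummableZ..].
  by congr rsum; apply/funext => i; rewrite ImM.
Qed.

Lemma csum_real I (f : I -> R) : csum (fun i => (f i)%:C) = (rsum f)%:C.
Proof.
rewrite /csum; apply: eq_Re_Im => //=.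
by rewrite ge0_rsum// esum1.
Qed.

Lemma csum_recl (f : nat -> R[i]) : csummable f ->
  csum f = f 0%N + csum (fun n => f n.+1).
Proof.
move=> fs; apply: eq_Re_Im; rewrite raddfD/=.
- by rewrite rsum_recl//; exact: csummable_Re.
- by rewrite rsum_recl//; exact: csummable_Im.
Qed.

Lemma exchange_csum I J (f : I -> J -> R[i]) :
  (\esum_(i in setT) \esum_(j in setT) (normc (f i j))%:E < +oo)%E ->
  csum (fun i => csum (f i)) = csum (fun j => csum (f^~ j)).
Proof.
move=> fs; rewrite /csum /=; congr (_ +i* _); apply: exchange_rsum;
  apply: le_lt_trans fs; apply: le_esum => i _; apply: le_esum => j _.
- by rewrite lee_fin normr_Re_le.
- by rewrite lee_fin normr_Im_le.
Qed.

(* Multiplying by a unimodular constant, one may assume that the sum is real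
   and non-negative, hence equal to the sum of the real parts. *)
Lemma normc_csum_le I (f : I -> R[i]) : csummable f ->
  ((normc (csum f))%:E <= \esum_(i in setT) (normc (f i))%:E)%E.
Proof.
move=> fs; set S := csum f.
have [S0|S0] := eqVneq (normc S) 0.
  by rewrite S0; apply: esum_ge0 => i _; rewrite lee_fin normc_ge0.
pose u : R[i] := (normc S)^-1%:C * S^*.
have NS : 0 < normc S by rewrite lt0r S0 normc_ge0.
have Sconj : S^* * S = (normc S ^+ 2)%:C.
  by rewrite sqr_normc; case: (S) => a b; apply: eq_Re_Im; rewrite ?ReM ?ImM/=; ring.
have uS : Re (u * S) = normc S.
  by rewrite /u -mulrA Sconj -rmorphM/= expr2 mulKf.
have nu : normc u = 1.
  rewrite /u Normc.normcM normc_real ger0_norm ?invr_ge0 ?normc_ge0//.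
  suff -> : normc S^* = normc S by rewrite mulVf.
  by case: (S) => a b /=; rewrite sqrrN.
have us : csummable (fun i => u * f i) by exact: csummableZ.
have fE : (\esum_(i in setT) (normc (f i))%:E)%E = (rsum (fun i => normc (f i)))%:E.
  rewrite ge0_rsum; last by move=> i; exact: normc_ge0.
  rewrite fineK// ge0_fin_numE// esum_ge0// => i _; rewrite lee_fin; exact: normc_ge0.
rewrite fE lee_fin -uS -csumZ//=.
apply: ler_rsum; first exact: csummable_Re.
  apply: le_lt_trans fs; apply: le_esum => i _; rewrite ger0_norm//; exact: normc_ge0.
move=> i; apply: le_trans (ler_norm _) _; apply: le_trans (normr_Re_le _) _.
by rewrite Normc.normcM nu mul1r.
Qed.

End ComplexSums.

(** * Spectral radius *)

Section ComplexSequences.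
Context {R : realType} {I : countType}.
Notation normc := (@Normc.normc R).
Implicit Types (x y : I -> R[i]) (v : I -> \bar R) (A B : I -> I -> R).

(** [cabs] and [creal] pass between complex sequences and extended vectors. Through [fine], [creal]
    sends infinite entries to 0, so it is faithful only on finite ones. *)
Definition cabs x : I -> \bar R := fun i => (normc (x i))%:E.

Definition creal v : I -> R[i] := fun i => (fine (v i))%:C.

Lemma cabs_ge0 x : nneg_vec (cabs x).
Proof. by move=> i; rewrite lee_fin normc_ge0. Qed.

Lemma l2E x : l2 x <-> (ip (cabs x) (cabs x) < +oo)%E.
Proof. by []. Qed.

Lemma ip_cabs x : l2 x -> ip (cabs x) (cabs x) = (l2norm x ^+ 2)%:E.
Proof.
move=> xs; have s0 : (0 <= ip (cabs x) (cabs x))%E by apply: ip_ge0; exact: cabs_ge0.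
by rewrite /l2norm sqr_sqrtr ?fineK ?ge0_fin_numE ?fine_ge0.
Qed.

Lemma l2norm_ge0 x : 0 <= l2norm x.
Proof. exact: sqrtr_ge0. Qed.

Lemma l2norm_le x y K : 0 <= K -> l2 x ->
  (ip (cabs y) (cabs y) <= (K ^+ 2)%:E * ip (cabs x) (cabs x))%E ->
  l2 y /\ l2norm y <= K * l2norm x.
Proof.
move=> K0 xs; rewrite (ip_cabs xs) -EFinM -exprMn => le_yx.
have ys : l2 y by apply: le_lt_trans le_yx _; exact: ltry.
split=> //; move: le_yx; rewrite ip_cabs// lee_fin ler_pXn2r// nnegrE ?l2norm_ge0//.
by rewrite mulr_ge0// l2norm_ge0.
Qed.

Lemma creal_ge0 v i : 0 <= fine (v i) -> normc (creal v i) = fine (v i).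
Proof. by move=> v0; rewrite normc_real ger0_norm. Qed.

Lemma cabs_creal v : nneg_vec v -> (ip v v < +oo)%E -> cabs (creal v) = v.
Proof.
move=> v0 vs; apply/funext => i; rewrite /cabs creal_ge0; last exact: fine_ge0.
by rewrite fineK// (ip_lty_fin i v0 vs).
Qed.

Lemma l2_creal v : nneg_vec v -> (ip v v < +oo)%E -> l2 (creal v).
Proof. by move=> v0 vs; rewrite l2E cabs_creal. Qed.

(** Coordinatewise [(q r + s)^2 <= 2 q^2 r^2 + 2 s^2]. This stands in for the triangle
    inequality. *)
Lemma l2D (a : R[i]) x y : l2 x -> l2 y -> l2 (a *: x + y) /\
  l2norm (a *: x + y) ^+ 2 <= 2 * normc a ^+ 2 * l2norm x ^+ 2 + 2 * l2norm y ^+ 2.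
Proof.
move=> xs ys.
have key : (ip (cabs (a *: x + y)%R) (cabs (a *: x + y)%R) <=
    (2 * normc a ^+ 2 * l2norm x ^+ 2 + 2 * l2norm y ^+ 2)%:E)%E.
  have a2 : 0 <= 2 * normc a ^+ 2 by rewrite mulr_ge0// sqr_ge0.
  have c0 z i : (0 <= cabs z i * cabs z i)%E by rewrite mule_ge0// cabs_ge0.
  have -> : (2 * normc a ^+ 2 * l2norm x ^+ 2 + 2 * l2norm y ^+ 2)%:E =
      ((2 * normc a ^+ 2)%:E * ip (cabs x) (cabs x) + 2%:E * ip (cabs y) (cabs y))%E.
    by rewrite (ip_cabs xs) (ip_cabs ys).
  apply: (@le_trans _ _ (\esum_(i in setT) ((2 * normc a ^+ 2)%:E * (cabs x i * cabs x i) +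
      2%:E * (cabs y i * cabs y i)))%E).
    apply: le_esum => i _; rewrite -!EFinM -EFinD lee_fin.
    have : normc ((a *: x + y) i) <= normc a * normc (x i) + normc (y i).
      by rewrite -Normc.normcM; exact: le_normcD.
    have := normc_ge0 ((a *: x + y) i).
    move: (normc (_ i)) (normc a) (normc (x i)) (normc (y i)) => p q r s p0 pqrs.
    have := sqr_ge0 (q * r - s); nra.
  rewrite esumD; try by move=> i _; rewrite mule_ge0.
  by rewrite !esumZl.
have s : l2 (a *: x + y) by apply: le_lt_trans key _; exact: ltry.
by split=> //; rewrite -lee_fin -ip_cabs.
Qed.

Lemma bounded_operatorB (S : (I -> R[i]) -> I -> R[i]) (z : R[i]) x y :
  bounded_operator S -> l2 x -> l2 y -> S (z *: x - y) = z *: S x - S y.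
Proof.
move=> [_ lin _] xs ys.
have l20 : l2 (0 : I -> R[i]).
  rewrite l2E [X in (X < _)%E](_ : _ = 0%E) ?ltry// /ip esum1// => i _.
  by rewrite /cabs Normc.normc0 mule0.
have S0 : S 0 = 0.
  have := lin 1 0 0 l20 l20; rewrite !scale1r addr0 => /eqP.
  by rewrite -subr_eq subrr => /eqP <-.
have SN : S (- y) = - S y.
  by have := lin (-1) y 0 ys l20; rewrite S0 !addr0 !scaleN1r.
have yN : l2 (- y) by have [+ _] := l2D (-1) ys l20; rewrite addr0 scaleN1r.
by rewrite lin// SN.
Qed.

Section MatrixOperator.
Variables (A : I -> I -> R) (c : R).
Hypotheses (A0 : nonneg_matrix A) (Ac : op_bound (mv A) c).

Lemma mv_cabs_fin x i : l2 x -> mv A (cabs x) i \is a fin_num.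
Proof.
move=> xs; apply: ip_lty_fin; first exact/mv_ge0/cabs_ge0.
have [_ _ /(_ _ (cabs_ge0 x))/le_lt_trans] := Ac; apply.
by rewrite ip_cabs// -EFinM ltry.
Qed.

Lemma esum_matrix_row x i :
  (\esum_(j in setT) (normc ((A i j)%:C * x j))%:E)%E = mv A (cabs x) i.
Proof.
by apply: eq_esum => j _; rewrite Normc.normcM normc_real ger0_norm// EFinM.
Qed.

Lemma matrix_op_csummable x i : l2 x -> csummable (fun j => (A i j)%:C * x j).
Proof.
move=> xs; rewrite /csummable esum_matrix_row.
by have := mv_cabs_fin i xs; rewrite fin_numElt => /andP[].
Qed.

Lemma cabs_matrix_op x i : l2 x -> (cabs (matrix_op A x) i <= mv A (cabs x) i)%E.
Proof.
by move=> xs; rewrite -esum_matrix_row normc_csum_le//; exact: matrix_op_csummable.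
Qed.

Lemma l2_matrix_op x : l2 x -> l2 (matrix_op A x) /\ l2norm (matrix_op A x) <= c * l2norm x.
Proof.
have [c0 _ Ac'] := Ac; move=> xs; apply: l2norm_le => //; first exact: ltW.
apply: le_trans (Ac' _ (cabs_ge0 x)).
by apply: le_ip; [exact: cabs_ge0..| |]; move=> i; exact: cabs_matrix_op.
Qed.

Lemma matrix_op_linear (a : R[i]) x y : l2 x -> l2 y ->
  matrix_op A (a *: x + y) = a *: matrix_op A x + matrix_op A y.
Proof.
move=> xs ys; apply/funext => i; rewrite /matrix_op /=.
have xi := matrix_op_csummable i xs; have yi := matrix_op_csummable i ys.
transitivity (csum (fun j => a * ((A i j)%:C * x j) + (A i j)%:C * y j)).
  by congr csum; apply/funext => j; rewrite [LHS]mulrDr; congr (_ + _); exact: mulrCA.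
by rewrite csumD ?csumZ//; exact: csummableZ.
Qed.

(** An infinite row sum becomes 0 on both sides through [fine], so the identity can serve before
    boundedness is known. *)
Lemma matrix_op_creal v : nneg_vec v -> (ip v v < +oo)%E ->
  matrix_op A (creal v) = creal (mv A v).
Proof.
move=> v0 vs; apply/funext => i; rewrite /matrix_op /creal.
have vfin j := ip_lty_fin j v0 vs.
transitivity (csum (fun j => (A i j * fine (v j))%:C)).
  by congr csum; apply/funext => j; rewrite rmorphM.
rewrite csum_real ge0_rsum; last by move=> j; rewrite mulr_ge0// fine_ge0.
by congr (_%:C); congr fine; apply: eq_esum => j _; rewrite EFinM fineK.
Qed.

End MatrixOperator.

(** Square summability of [matrix_op A] alone would not control [mv A], as [fine] hides infinite
    entries; the row summability in [defines_operator] rules these out. *)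
Lemma defines_operator_bounded A : nonneg_matrix A -> defines_operator A ->
  exists c, op_bound (mv A) c.
Proof.
move=> A0 Adef; apply: nonneg_matrix_bounded => // v v0 vs.
have [Asum +] := Adef _ (l2_creal v0 vs); rewrite matrix_op_creal//.
have vE := cabs_creal v0 vs.
have fin i : mv A v i \is a fin_num.
  have := Asum i; rewrite /csummable esum_matrix_row// vE => fi.
  by rewrite ge0_fin_numE// mv_ge0.
rewrite l2E; congr (_ < _)%E; apply: eq_esum => i _.
by rewrite /cabs creal_ge0 ?fineK// fine_ge0// mv_ge0.
Qed.

End ComplexSequences.

(** * Spectral radius and growth of powers *)

Section Resolvent.
Context {R : realType} {I : countType}.
Notation normc := (@Normc.normc R).
Variables (B : I -> I -> R).
Hypothesis B0 : nonneg_matrix B.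
Implicit Types (x y : I -> R[i]) (s t b : R).

Lemma normcX (z : R[i]) n : normc (z ^+ n) = normc z ^+ n.
Proof.
elim: n => [|n IH]; first by rewrite !expr0 Normc.normc1.
by rewrite !exprS Normc.normcM IH.
Qed.

(** The resolvent is [S x = \sum_n z^-(n+1) B^n x]. The bounded [neumann] at [|z|] dominates it
    entrywise, which yields convergence, boundedness and the exchange of [B] with the sum. *)
Lemma resolvent_of_power_bound t z : power_bound (mv B) t -> t < normc z ->
  resolvent_set (matrix_op B) z.
Proof.
move=> Bt tz; have [t0 [C Bn]] := Bt.
have z0 : 0 < normc z := lt_trans t0 tz.
have zn0 : z != 0 by apply: contraTneq z0 => ->; rewrite Normc.normc0 ltxx.
have Bb := Bn 1%N; rewrite /= in Bb.
have [K Kz] := neumann_bound B0 tz Bt.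
pose w n x := iter n (matrix_op B) x.
have wl2 n x : l2 x -> l2 (w n x).
  by move=> xs; elim: n => //= n IH; have [] := l2_matrix_op B0 Bb IH.
have wabs n x i : l2 x -> (cabs (w n x) i <= iter n (mv B) (cabs x) i)%E.
  move=> xs; elim: n i => //= n IH i.
  apply: le_trans (cabs_matrix_op B0 Bb i (wl2 n _ xs)) _.
  exact: le_mv.
have wlin n (a : R[i]) x y : l2 x -> l2 y -> w n (a *: x + y) = a *: w n x + w n y.
  move=> xs ys; elim: n => //= n ->.
  by rewrite (matrix_op_linear B0 Bb)//; exact: wl2.
pose c n : R[i] := z^-1 ^+ n.+1.
have normcc n : normc (c n) = (normc z)^-1 ^+ n.+1 by rewrite normcX Normc.normcV.
pose S x i := csum (fun n => c n * w n x i).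
have neufin x i : l2 x -> neumann B (normc z) (cabs x) i \is a fin_num.
  move=> xs; apply: ip_lty_fin; first by apply: neumann_ge0 => //; exact: cabs_ge0.
  have [_ _ /(_ _ (cabs_ge0 x))/le_lt_trans] := Kz; apply.
  by rewrite ip_cabs// -EFinM ltry.
have Ssum_le x i : l2 x ->
    (\esum_(n in setT) (normc (c n * w n x i))%:E <= neumann B (normc z) (cabs x) i)%E.
  move=> xs; apply: le_esum => n _; rewrite Normc.normcM EFinM normcc.
  apply: lee_wpmul2l; last exact: wabs.
  by rewrite lee_fin exprn_ge0// invr_ge0 ltW.
have Ssum x i : l2 x -> csummable (fun n => c n * w n x i).
  move=> xs; apply: le_lt_trans (Ssum_le x i xs) _.
  by have := neufin x i xs; rewrite fin_numElt => /andP[].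
have Sl2 x : l2 x -> l2 (S x) /\ l2norm (S x) <= K * l2norm x.
  have [K0 _ Kz'] := Kz.
  move=> xs; apply: l2norm_le => //; first exact: ltW.
  have SK i : (cabs (S x) i <= neumann B (normc z) (cabs x) i)%E.
    exact: le_trans (normc_csum_le (Ssum x i xs)) (Ssum_le x i xs).
  apply: le_trans (Kz' _ (cabs_ge0 x)).
  by apply: le_ip => //; exact: cabs_ge0.
have Slin (a : R[i]) x y : l2 x -> l2 y -> S (a *: x + y) = a *: S x + S y.
  move=> xs ys; apply/funext => i; rewrite /S /=.
  have xi := Ssum x i xs; have yi := Ssum y i ys.
  transitivity (csum (fun n => a * (c n * w n x i) + c n * w n y i)).
    by congr csum; apply/funext => n; rewrite wlin//= [LHS]mulrDr; congr (_ + _); exact: mulrCA.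
  by rewrite csumD ?csumZ//; exact: csummableZ.
have Sbd : bounded_operator S.
  by split=> [x /Sl2[]//|//|]; exists K => x /Sl2[].
have SB x i : l2 x -> S (matrix_op B x) i = csum (fun n => c n * w n.+1 x i).
  by move=> xs; congr csum; apply/funext => n; rewrite /w iterSr.
have BS x i : l2 x -> matrix_op B (S x) i = csum (fun n => c n * w n.+1 x i).
  move=> xs; rewrite /matrix_op.
  transitivity (csum (fun j => csum (fun n => (B i j)%:C * (c n * w n x j)))).
    by congr csum; apply/funext => j; rewrite csumZ//; exact: Ssum.
  rewrite exchange_csum; last first.
    apply: (@le_lt_trans _ _ (mv B (neumann B (normc z) (cabs x)) i)).
      apply: le_esum => j _.
      rewrite (eq_esum (b := fun n => ((B i j)%:E * (normc (c n * w n x j))%:E)%E)); last first.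
        by move=> n _; rewrite Normc.normcM normc_real ger0_norm// EFinM.
      rewrite esumZl ?lee_fin//; last by move=> n; rewrite lee_fin normc_ge0.
      by apply: lee_wpmul2l; rewrite ?lee_fin//; exact: Ssum_le.
    have n0 := neumann_ge0 B0 z0 (cabs_ge0 x).
    suff : mv B (neumann B (normc z) (cabs x)) i \is a fin_num.
      by rewrite fin_numElt => /andP[].
    apply: ip_lty_fin; first exact: mv_ge0.
    have [_ _ /(_ _ n0)/le_lt_trans] := Bb; apply.
    apply: lte_mul_pinfty; rewrite ?lee_fin ?sqr_ge0//.
    have [_ _ /(_ _ (cabs_ge0 x))/le_lt_trans] := Kz; apply.
    by rewrite ip_cabs// -EFinM ltry.
  congr csum; apply/funext => n.
  transitivity (csum (fun j => c n * ((B i j)%:C * w n x j))).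
    by congr csum; apply/funext => j; rewrite mulrCA.
  by rewrite csumZ//; apply: (matrix_op_csummable B0 Bb); exact: wl2.
(* Multiplication by [z] splits off the term [x] and shifts the series. Subtracting [SB] or [BS]
   leaves [x], so [S] is an inverse on both sides. *)
have zS x : l2 x -> z *: S x = (fun i => x i + csum (fun n => c n * w n.+1 x i)).
  move=> xs; apply/funext => i.
  transitivity (z * S x i); first by [].
  rewrite /S csum_recl; last exact: Ssum.
  rewrite mulrDr /c expr1 mulVKf//; congr (_ + _).
  rewrite -csumZ.
    by congr csum; apply/funext => n; rewrite mulrA (exprS _ n.+1) mulVKf.
  have := Ssum x i xs; apply: le_lt_trans.
  by rewrite [leRHS]esum_nat_recl ?leeDr// => *; rewrite lee_fin normc_ge0.
exists S => // x xs.
have [Bxs _] := l2_matrix_op B0 Bb xs.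
split.
- rewrite (bounded_operatorB _ Sbd)// zS//; apply/funext => i.
  by rewrite -[LHS]/(x i + csum _ - S (matrix_op B x) i) SB// addrK.
- rewrite zS//; apply/funext => i.
  by rewrite -[LHS]/(x i + csum _ - matrix_op B (S x) i) BS// addrK.
Qed.

Lemma spectrum_ub t : power_bound (mv B) t ->
  ubound [set normc z | z in spectrum (matrix_op B)] t.
Proof.
move=> Bt _ [z zs <-]; rewrite leNgt; apply/negP => tz; apply: zs.
exact: resolvent_of_power_bound Bt tz.
Qed.

Lemma matrix_rho_le t : power_bound (mv B) t -> matrix_rho B <= t.
Proof.
move=> Bt; have [t0 _] := Bt; rewrite /matrix_rho /spectral_radius.
(* The supremum of the empty set is 0, so an empty spectrum causes no trouble. *)
have [->|/set0P ne] := eqVneq [set normc z | z in spectrum (matrix_op B)] set0.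
  by rewrite sup0 ltW.
by apply: ge_sup => //; exact: spectrum_ub.
Qed.

Lemma matrix_rho_ge0 t : power_bound (mv B) t -> 0 <= matrix_rho B.
Proof.
move=> Bt; rewrite /matrix_rho /spectral_radius.
have [->|/set0P[_ [z zs _]]] := eqVneq [set normc z | z in spectrum (matrix_op B)] set0.
  by rewrite sup0.
apply: le_trans (normc_ge0 z) _; apply: ub_le_sup; last by exists z.
by exists t; exact: spectrum_ub.
Qed.

Lemma power_bound_le s t : s <= t -> power_bound (mv B) s -> power_bound (mv B) t.
Proof.
move=> st [s0 [C Bn]]; split; first exact: lt_le_trans st.
have [C0 _ _] := Bn 0%N; rewrite expr0 mulr1 in C0.
exists C => n; apply: op_bound_le (Bn n).
rewrite ler_wpM2l ?(ltW C0)// lerXn2r// nnegrE ltW//.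
exact: lt_le_trans st.
Qed.

(* From [y = (t0 - t) S y + S x] for [y = neumann t x] and the resolvent [S] at
   [t0], the norm of [neumann t] stays bounded as [t] decreases to [t0]. *)
Lemma neumann_bound_near (t0 : R) : 0 < t0 -> resolvent_set (matrix_op B) t0%:C ->
  (forall t : R, t0 < t -> power_bound (mv B) t) ->
  exists M d : R, 0 < d /\ forall t : R, t0 < t < t0 + d -> op_bound (neumann B t) M.
Proof.
move=> t00 [S Sbd SB] Bt.
have [Sl2 Slin [M' SM']] := Sbd.
have [b Bb] : exists b, op_bound (mv B) b.
  by have [|_ [C /(_ 1%N)]] := Bt (t0 + 1); [rewrite ltrDl|exists (C * (t0 + 1) ^+ 1)].
pose M := Num.max M' 1.
have M0 : 0 < M by rewrite lt_max ltr01 orbT.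
have SM x : l2 x -> l2norm (S x) <= M * l2norm x.
  move=> xs; apply: le_trans (SM' x xs) _; rewrite ler_wpM2r ?l2norm_ge0//.
  by rewrite le_max lexx.
(* For these [t] one has [|t0 - t| M <= 1 / 2]. The norm [a] of [y] then satisfies
   [a^2 <= a^2 / 2 + 2 M^2 |v|^2], that is [a <= 2 M |v|]. *)
exists (2 * M), (2 * M)^-1; split; first by rewrite invr_gt0 mulr_gt0.
move=> t /andP[t0t td]; have tp : 0 < t := lt_trans t00 t0t.
split; first by rewrite mulr_gt0.
  by move=> v; exact: neumann_ge0.
move=> v v0.
have [voo|vfin] := eqVneq (ip v v) +oo%E.
  by rewrite voo gt0_muley ?leey// lte_fin exprn_gt0// mulr_gt0.
have {vfin} vs : (ip v v < +oo)%E by rewrite ltey.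
have y0 := neumann_ge0 B0 tp v0.
set y := neumann B t v in y0 *.
(* Absorbing [a^2 / 2] requires [a] to be finite. For each single [t] this follows from a power
   bound at the midpoint of [t0] and [t]. *)
have ys : (ip y y < +oo)%E.
  have st : (t0 + t) / 2 < t by lra.
  have [|K [K0 _ /(_ _ v0)/le_lt_trans]] := neumann_bound B0 st (Bt _ _); first by lra.
  by apply; apply: lte_mul_pinfty; rewrite ?lee_fin ?sqr_ge0.
have xl := l2_creal v0 vs; have yl := l2_creal y0 ys.
have yfin i := ip_lty_fin i y0 ys.
have By0 := mv_ge0 B0 y0.
have Bys : (ip (mv B y) (mv B y) < +oo)%E.
  have [_ _ /(_ _ y0)/le_lt_trans] := Bb; apply.
  by apply: lte_mul_pinfty; rewrite ?lee_fin ?sqr_ge0.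
have eqn : t0%:C *: creal y - matrix_op B (creal y) = (t0 - t)%:C *: creal y + creal v.
  rewrite (matrix_op_creal B0 y0 ys); apply/funext => i.
  have := neumann_eq B0 i tp v0; rewrite -/y => /(congr1 fine).
  rewrite fineM ?fineD ?(ip_lty_fin i v0 vs) ?(ip_lty_fin i By0 Bys)//= => tyE.
  transitivity ((t0 * fine (y i) - fine (mv B y i))%:C).
    by rewrite rmorphB rmorphM.
  transitivity (((t0 - t) * fine (y i) + fine (v i))%:C).
    by congr _%:C; lra.
  by rewrite rmorphD rmorphM.
have Syl := Sl2 _ yl; have Sxl := Sl2 _ xl.
have yE : creal y = (t0 - t)%:C *: S (creal y) + S (creal v).
  by have [SBy _] := SB _ yl; rewrite -{1}SBy eqn Slin.
have [_ +] := l2D (t0 - t)%:C Syl Sxl; rewrite -yE normc_real.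
have := SM _ yl; have := SM _ xl; have := ip_cabs xl; have := ip_cabs yl.
rewrite !cabs_creal// => -> ->; rewrite -EFinM lee_fin.
have := l2norm_ge0 (S (creal y)); have := l2norm_ge0 (S (creal v)).
have := l2norm_ge0 (creal y).
move: (l2norm (S (creal v))) (l2norm (S (creal y))) (l2norm (creal y))
  (l2norm (creal v)) => q p a b'.
have hM : `|t0 - t| * M <= 1 / 2.
  rewrite distrC ger0_norm; last by lra.
  have : (t - t0) * M <= (2 * M)^-1 * M by rewrite ler_wpM2r ?(ltW M0)//; lra.
  by rewrite invfM -mulrA mulVf ?gt_eqF//; lra.
have := normr_ge0 (t0 - t).
move: `|t0 - t| hM => h hM h0 a0 q0 p0 qM pM.
have hp : 0 <= h * p <= a / 2.
  rewrite mulr_ge0//=; apply: (@le_trans _ _ (h * (M * a))); first by rewrite ler_wpM2l.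
  by nra.
have qq : q ^+ 2 <= (M * b') ^+ 2 by rewrite lerXn2r ?nnegrE//; lra.
have pp : (h * p) ^+ 2 <= (a / 2) ^+ 2 by rewrite lerXn2r ?nnegrE//; lra.
by move=> aa; nra.
Qed.

(** If the infimum of the power bounds exceeded the spectral radius, it would lie in the resolvent
    set, and [power_bound_improve] would provide a power bound below it. *)
Lemma power_bound_of_rho b t : op_bound (mv B) b -> matrix_rho B < t ->
  power_bound (mv B) t.
Proof.
move=> Bb rt.
pose E := [set s | power_bound (mv B) s].
have Eb : E b by exact: op_bound_power.
have rho0 := matrix_rho_ge0 Eb.
have Einf : has_inf E.
  by split; [exists b|exists 0 => s [/ltW]].
have [t0rho|rhot0] := leP (inf E) (matrix_rho B).
  have [s Es st] := inf_lt (proj1 Einf) (le_lt_trans t0rho rt).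
  by apply: power_bound_le Es; exact: ltW.
exfalso.
have t00 : 0 < inf E := le_lt_trans rho0 rhot0.
have gtE s : inf E < s -> power_bound (mv B) s.
  move=> /(inf_lt (proj1 Einf))[s' Es' s's].
  by apply: power_bound_le Es'; exact: ltW.
(* Otherwise [inf E] would be the modulus of a spectral value and exceed the supremum of all such
   moduli. *)
have res : resolvent_set (matrix_op B) (inf E)%:C.
  apply: contrapT => nres; move: rhot0; rewrite ltNge => /negP; apply.
  rewrite -[inf E]gtr0_norm// -normc_real; apply: ub_le_sup.
    by exists b; exact: spectrum_ub.
  by exists (inf E)%:C.
have [M [d [d0 neuM]]] := neumann_bound_near t00 res gtE.
have [s st Es] := power_bound_improve B0 t00 d0 (ex_intro _ b Bb) neuM.
by move: st; rewrite ltNge => /negP; apply; apply: ge_inf => //; case: Einf.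
Qed.

End Resolvent.

(** * Products of matrices *)

Section Runs.
Local Open Scope ereal_scope.
Context {R : realType} {I : countType}.
Implicit Types (A B : I -> I -> R) (Y Z : nat -> I -> I -> R) (v w x : I -> \bar R).

(* [Z 0] is applied first: it is the rightmost factor of the product. *)
Fixpoint run Z n v := if n is p.+1 then mv (Z p) (run Z p v) else v.

Lemma run_ge0 Z n v : (forall p, nonneg_matrix (Z p)) -> nneg_vec v ->
  nneg_vec (run Z n v).
Proof. by move=> Z0 v0; elim: n => //= n; exact: mv_ge0. Qed.

Lemma runD Z a b v : run Z (a + b) v = run (fun q => Z (a + q)%N) b (run Z a v).
Proof. by elim: b => [|b IH]; rewrite ?addn0// addnS/= IH. Qed.

Lemma eq_run Y Z n : Y =1 Z -> run Y n =1 run Z n.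
Proof. by move=> /funext ->. Qed.

Lemma run_periodic Z L n v : (forall q, Z (L + q)%N = Z q) ->
  run Z (n * L) v = iter n (run Z L) v.
Proof.
move=> ZL; elim: n v => // n IH v; rewrite mulSn runD iterSr -IH.
by apply: eq_run => q; exact: ZL.
Qed.

Lemma op_bound_run Z n : (forall p, exists c, op_bound (mv (Z p)) c) ->
  exists c, op_bound (run Z n) c.
Proof.
move=> Zb; elim: n => [|n [c IH]]; first by exists 1%R; exact: op_bound_id.
by have [b Zn] := Zb n; exists (b * c)%R; exact: op_bound_comp Zn IH.
Qed.

(** Each step moves [Z k] from the right end of the word to the left end, where periodicity puts it;
    this is [power_bound_cycle]. *)
Lemma power_bound_rotate Z L t k : (forall p, nonneg_matrix (Z p)) ->
  (forall p, exists c, op_bound (mv (Z p)) c) ->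
  (0 < L)%N -> (forall q, Z (L + q)%N = Z q) ->
  power_bound (run Z L) t -> power_bound (run (fun q => Z (k + q)%N) L) t.
Proof.
case: L => // n Z0 Zb _ ZL Zt; elim: k => [|k IH]; first by [].
have [c Zk] := Zb k.
have [b Zkb] := op_bound_run n (fun p => Zb (k.+1 + p)%N).
apply: (@power_bound_ext _ _ (mv (Z k) \o run (fun q => Z (k.+1 + q)%N) n)).
  by move=> v _ /=; rewrite [(k.+1 + n)%N]addSnnS addnC ZL.
apply: power_bound_cycle Zkb Zk _.
apply: power_bound_ext IH => v _; rewrite -add1n runD/= addn0.
by apply: eq_run => q; rewrite addnA addn1.
Qed.

Lemma run_adjoint Z n v w : (forall p, nonneg_matrix (Z p)) ->
  nneg_vec v -> nneg_vec w ->
  ip (run Z n v) w = ip v (foldr (fun p => mv (transpose (Z p))) w (iota 0 n)).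
Proof.
move=> Z0 v0; elim: n w => // n IH w w0.
rewrite [run _ _ _]/= mv_adjoint//; last exact: run_ge0.
rewrite IH; first by rewrite -addn1 iotaD foldr_cat add0n.
by apply: mv_ge0 => //; exact: transpose_ge0.
Qed.

(** Reduces a comparison of words on a vector to one of their entries [run Z n (unit_vec j) i]. *)
Lemma run_decompose Z n x : (forall p, nonneg_matrix (Z p)) -> nneg_vec x ->
  forall i, run Z n x i = \esum_(j in setT) (x j * run Z n (unit_vec j) i).
Proof.
move=> Z0 x0; elim: n => [|n IH] i /=.
  rewrite (@esum_delta _ _ _ i) /unit_vec ?eqxx ?mule1// => j ji.
  by rewrite eq_sym (negPf ji) mule0.
rewrite (_ : run Z n x = fun i => \esum_(j in setT) (x j * run Z n (unit_vec j) i)); last first.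
  by apply/funext => k; exact: IH.
have r0 j := run_ge0 n Z0 (@unit_vec_ge0 R I j).
rewrite (@mv_esum _ _ _ _ (fun j i => x j * run Z n (unit_vec j) i))//; last first.
  by move=> j k; rewrite mule_ge0// r0.
by apply: eq_esum => j _; rewrite mvZ.
Qed.

(** For non-negative terms, a sum of products is at most the product of the sums; apply this at each
    multiplication. *)
Lemma run_hadamard2 Y Z n i j : (forall p, nonneg_matrix (Y p)) ->
  (forall p, nonneg_matrix (Z p)) ->
  run (fun p i j => (Y p i j * Z p i j)%R) n (unit_vec j) i <=
  run Y n (unit_vec j) i * run Z n (unit_vec j) i.
Proof.
move=> Y0 Z0; have Yr0 q := run_ge0 q Y0 (@unit_vec_ge0 R I j).
have Zr0 q := run_ge0 q Z0 (@unit_vec_ge0 R I j).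
elim: n i => [|n IH] i /=.
  by rewrite /unit_vec; case: (i == j); rewrite ?mule1 ?mule0.
have YZ0 k : 0 <= (Y n i k)%:E * run Y n (unit_vec j) k by exact: mv_term_ge0.
have ZZ0 k : 0 <= (Z n i k)%:E * run Z n (unit_vec j) k by exact: mv_term_ge0.
rewrite {3}/mv -esumZl//; last by apply: esum_ge0.
apply: le_esum => k _.
apply: (@le_trans _ _ ((Y n i k)%:E * run Y n (unit_vec j) k *
    ((Z n i k)%:E * run Z n (unit_vec j) k))).
  rewrite muleACA EFinM; apply: lee_wpmul2l; last exact: IH.
  by rewrite mule_ge0// lee_fin; [exact: Y0|exact: Z0].
apply: lee_wpmul2r => //.
exact: (@le_esum_term _ _ (fun k => (Y n i k)%:E * run Y n (unit_vec j) k)).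
Qed.

(** All words but the one of index 0 are replaced by bounds on their entries. That one is kept, so
    that the estimate can still be summed against a vector of finite norm. *)
Lemma run_hadamard m (Y : nat -> nat -> I -> I -> R) n (c : nat -> R) :
  (forall k p, nonneg_matrix (Y k p)) -> (forall k, 0 <= c k)%R ->
  (forall k i j, run (Y k) n (unit_vec j) i <= (c k)%:E) ->
  forall i j, run (fun p i j => (\prod_(k < m.+1) Y k p i j)%R) n (unit_vec j) i <=
    (\prod_(k < m) c k.+1)%:E * run (Y 0%N) n (unit_vec j) i.
Proof.
move=> Y0 c0 Yc i j; elim: m => [|m IH].
  rewrite big_ord0 mul1e.
  rewrite (@eq_run _ (Y 0%N))// => p; apply/funext => k; apply/funext => l.
  by rewrite big_ord_recl big_ord0 mulr1.
rewrite (@eq_run _ (fun p i j => (\prod_(k < m.+1) Y k p i j * Y m.+1 p i j)%R)); last first.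
  by move=> p; apply/funext => k; apply/funext => l; rewrite big_ord_recr.
have P0 p : nonneg_matrix (fun i j => \prod_(k < m.+1) Y k p i j)%R.
  by move=> k l; apply: prodr_ge0 => q _; exact: Y0.
apply: le_trans (run_hadamard2 _ _ _ P0 (Y0 m.+1)) _.
have rY k := run_ge0 n (Y0 k) (@unit_vec_ge0 R I j) i.
have rP := run_ge0 n P0 (@unit_vec_ge0 R I j) i.
apply: le_trans (lee_pmul rP (rY m.+1) IH (Yc m.+1 i j)) _.
by rewrite big_ord_recr/= EFinM muleAC.
Qed.

Lemma op_bound_unit T c i j : op_bound T c -> T (@unit_vec R I j) i <= c%:E.
Proof.
move=> [c0 T0 Tc]; have u0 := @unit_vec_ge0 R I j.
have := le_trans (sqr_le_ip i (T0 _ u0)) (Tc _ u0); rewrite ip_unit mule1.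
have := T0 _ u0 i; case: (T _ _) => [r||]//.
rewrite -EFinM !lee_fin => r0; rewrite -expr2 ler_pXn2r// nnegrE ltW//.
Qed.

End Runs.

(** * Matrix products as compositions *)

Section MatrixProducts.
Local Open Scope ereal_scope.
Context {R : realType} {I : countType}.
Implicit Types (A B : I -> I -> R) (F : nat -> I -> I -> R) (v : I -> \bar R).

Lemma matrix_mul_ge0 A B : nonneg_matrix A -> nonneg_matrix B ->
  nonneg_matrix (matrix_mul A B).
Proof.
move=> A0 B0 i k; rewrite /matrix_mul ge0_rsum; last by move=> j; rewrite mulr_ge0.
by apply/fine_ge0/esum_ge0 => j _; rewrite lee_fin mulr_ge0.
Qed.

(** The bounds make the entries of the product finite, so that the [fine] inside [matrix_mul] loses
    nothing; the rest is Tonelli. *)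
Lemma mv_matrix_mul A B a b v : nonneg_matrix A -> nonneg_matrix B ->
  op_bound (mv A) a -> op_bound (mv B) b -> nneg_vec v ->
  mv (matrix_mul A B) v = mv A (mv B v).
Proof.
move=> A0 B0 Aa Bb v0.
have ABE i k : (matrix_mul A B i k)%:E = \esum_(j in setT) (A i j * B j k)%:E.
  rewrite /matrix_mul ge0_rsum; last by move=> j; rewrite mulr_ge0.
  rewrite fineK// (_ : \esum_(j in setT) _ = mv A (mv B (unit_vec k)) i); last first.
    by apply: eq_esum => j _; rewrite mv_unit// EFinM.
  apply: ip_lty_fin; first by do 2!apply: mv_ge0 => //; exact: unit_vec_ge0.
  have [_ _ /(_ _ (@unit_vec_ge0 R I k))/le_lt_trans] := op_bound_comp Aa Bb.
  by apply; rewrite ip_unit mule1 ltry.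
apply/funext => i; rewrite /mv.
transitivity (\esum_(k in setT) \esum_(j in setT) ((A i j)%:E * ((B j k)%:E * v k))).
  apply: eq_esum => k _; rewrite ABE -esumZr//; last by move=> j; rewrite lee_fin mulr_ge0.
  by apply: eq_esum => j _; rewrite EFinM muleA.
rewrite exchange_esum; last by move=> k j; rewrite !mule_ge0 ?lee_fin.
apply: eq_esum => j _; rewrite esumZl ?lee_fin// => k.
by rewrite mule_ge0 ?lee_fin.
Qed.

Lemma matrix_prodP (s : seq nat) F :
  (forall k, k \in s -> nonneg_matrix (F k) /\ exists c, op_bound (mv (F k)) c) ->
  [/\ nonneg_matrix (matrix_prod s F), exists c, op_bound (mv (matrix_prod s F)) c
    & forall v, nneg_vec v -> mv (matrix_prod s F) v = foldr (fun k => mv (F k)) v s].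
Proof.
rewrite /matrix_prod; elim: s => [|k s IH] Fs.
  have id1 v : nneg_vec v -> v = mv (@matrix_one R I) v.
    move=> v0; apply/funext => i; rewrite /mv (@esum_delta _ _ _ i).
    - by rewrite /matrix_one eqxx mul1e.
    - by move=> j ji; rewrite /matrix_one eq_sym (negPf ji) mul0e.
    - by rewrite /matrix_one eqxx mul1e.
  rewrite big_nil; split.
  - by move=> i j; rewrite /matrix_one ler0n.
  - by exists 1%R; apply: op_bound_ext (@op_bound_id R I) => v v0; exact: id1.
  - by move=> v v0 /=; rewrite -id1.
have [Fk0 [c Fkc]] := Fs k (mem_head _ _).
have [|P0 [b Pb] PE] := IH; first by move=> l ls; apply: Fs; rewrite inE ls orbT.
rewrite big_cons; split; first exact: matrix_mul_ge0.
- exists (c * b)%R; apply: op_bound_ext (op_bound_comp Fkc Pb) => v v0 /=.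
  by rewrite (mv_matrix_mul Fk0 P0 Fkc Pb).
- by move=> v v0; rewrite (mv_matrix_mul Fk0 P0 Fkc Pb)//= PE.
Qed.

End MatrixProducts.

(** * Growth of real sequences *)

Lemma log_convex_growth (R : realFieldType) (a : nat -> R) N : (forall n, 0 <= a n) ->
  (forall n, a n.+1 ^+ 2 <= a n * a n.+2) -> a 1%N ^+ N * a 0%N <= a 0%N ^+ N * a N.
Proof.
move=> a0 conv.
have step n : a 1%N * a n <= a 0%N * a n.+1.
  elim: n => [|n IH]; first by rewrite mulrC.
  have [an0|an0] := eqVneq (a n) 0.
    have : a n.+1 = 0.
      by apply/eqP; rewrite -sqrf_eq0 eq_le sqr_ge0 andbT (le_trans (conv n))// an0 mul0r.
    by move=> ->; rewrite mulr0 mulr_ge0.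
  have {}an0 : 0 < a n by rewrite lt0r an0 a0.
  rewrite -(ler_pM2r an0); have := conv n; have := a0 n.+1; have := a0 n.+2.
  have := a0 0%N; nra.
elim: N => [|N IH]; first by rewrite !expr0.
rewrite !exprS -mulrA; apply: (@le_trans _ _ (a 1%N * (a 0%N ^+ N * a N))).
  by rewrite ler_wpM2l.
by rewrite mulrCA -[leRHS]mulrA [leRHS]mulrCA ler_wpM2l ?exprn_ge0.
Qed.

(** Were [q > r], the powers of [q / r] would grow at least linearly by Bernoulli and exceed [C]. *)
Lemma le_of_power_le (R : realType) (C q r : R) : 0 <= q -> 0 < r ->
  (forall n, q ^+ n <= C * r ^+ n) -> q <= r.
Proof.
move=> q0 r0 qr; rewrite leNgt; apply/negP => rq.
pose h := q / r - 1.
have h0 : 0 < h by rewrite subr_gt0 ltr_pdivlMr// mul1r.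
have qE : q / r = 1 + h by rewrite /h addrC subrK.
have bern n : 1 + n%:R * h <= (q / r) ^+ n by rewrite qE bernoulli//; lra.
have bound n : n%:R * h <= C.
  apply: le_trans (_ : 1 + n%:R * h <= _); first by rewrite lerDr.
  apply: le_trans (bern n) _; rewrite expr_div_n ler_pdivrMr ?exprn_gt0//.
have := bound (Num.trunc (C / h)).+1; apply/negP; rewrite -ltNge -ltr_pdivrMr//.
exact: truncnS_gt.
Qed.


Lemma prod_modn_shift (R : comPzSemiRingType) (m p : nat) (G : nat -> R) : (0 < m)%N ->
  \prod_(k < m) G ((k + p) %% m)%N = \prod_(k < m) G k.
Proof.
case: m => // m _; elim: p => [|p IH].
  by apply: eq_bigr => k _; rewrite addn0 modn_small.
rewrite -[RHS]IH big_ord_recr [RHS]big_ord_recl/= mulrC add0n; congr (_ * _).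
  by rewrite addnS -addSn modnDl.
by apply: eq_bigr => k _; rewrite /bump/= add1n addnS addSn.
Qed.

(** * Alternating words and their Hadamard product *)

Section AlternatingProducts.
Context {R : realType} {I : countType}.
Implicit Types (M H : I -> I -> R) (A : nat -> I -> I -> R) (x : I -> \bar R).

Definition transpose_if (b : bool) M := if b then transpose M else M.

Lemma transpose_if_ge0 b M : nonneg_matrix M -> nonneg_matrix (transpose_if b M).
Proof. by case: b => //; exact: transpose_ge0. Qed.

Lemma transpose_if_bound b M c : nonneg_matrix M -> op_bound (mv M) c ->
  op_bound (mv (transpose_if b M)) c.
Proof. by move=> M0 Mc; case: b; [exact: op_bound_transpose|exact: Mc]. Qed.

(* The numbers [|u_n|^2], with [u_0 = x], [u_1 = H x], [u_2 = H^T H x], ...,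
   form a log-convex sequence. *)
Lemma alternating_moment (Z : nat -> I -> I -> R) x N :
  (forall p, nonneg_matrix (Z p)) -> (forall p, exists c, op_bound (mv (Z p)) c) ->
  (forall a b, odd (a + b) -> transpose (Z a) = Z b) ->
  nneg_vec x -> (ip x x < +oo)%E ->
  fine (ip (mv (Z 0%N) x) (mv (Z 0%N) x)) ^+ N * fine (ip x x) <=
  fine (ip x x) ^+ N * fine (ip x (run Z (N + N) x)).
Proof.
move=> Z0 Zb ZT x0 xs; pose u n := run Z n x.
have u0 n : nneg_vec (u n) by exact: run_ge0.
have us n : (ip (u n) (u n) < +oo)%E.
  elim: n => [//|n IH]; have [c [_ _ Zc]] := Zb n.
  apply: le_lt_trans (Zc _ (u0 n)) _.
  by apply: lte_mul_pinfty; rewrite ?lee_fin ?sqr_ge0.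
(* One factor crosses the inner product. Repeating this gives [<u_0, u_2N> = |u_N|^2], and once,
   [<u_n, u_(n+2)> = |u_(n+1)|^2], which Cauchy-Schwarz turns into log-convexity. *)
have swap a b : odd (a + b) -> ip (u a.+1) (u b) = ip (u a) (u b.+1).
  move=> ab; rewrite -[u a.+1]/(mv (Z a) (u a)) (mv_adjoint (Z0 a) (u0 a) (u0 b)).
  by rewrite (ZT _ _ ab).
have shift k : (k <= N)%N -> ip (u (N - k)%N) (u (N + k)%N) = ip (u N) (u N).
  elim: k => [|k IH] kN; first by rewrite subn0 addn0.
  rewrite -IH 1?ltnW// addnS -swap; last first.
    by rewrite -{2}(subnK kN) !oddD/=; case: (odd _); case: (odd k).
  by rewrite -subSn// subSS.
pose a n := fine (ip (u n) (u n)).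
have aE n : ip (u n) (u n) = (a n)%:E.
  by rewrite fineK// ge0_fin_numE// ip_ge0.
have conv n : a n.+1 ^+ 2 <= a n * a n.+2.
  have := @esum_CauchySchwarz _ _ (u n) (u n.+2) (u0 n) (u0 n.+2).
  rewrite -!/(ip _ _) -swap; last by rewrite addnS oddS oddD addbb.
  by rewrite !aE -!EFinM lee_fin.
have a0 n : 0 <= a n by rewrite -lee_fin -aE ip_ge0.
have := log_convex_growth N a0 conv.
by rewrite {4}/a -(shift N)// subnn.
Qed.

Section HadamardProduct.
Variables (m : nat) (A : nat -> I -> I -> R).
Hypotheses (m0 : (0 < m)%N)
  (AP : forall k, (1 <= k <= m)%N ->
     nonneg_matrix (A k) /\ exists c, op_bound (mv (A k)) c).

Let s := index_iota 1 m.+1.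

(** Matrices are numbered from 1, hence the successor. Transposition follows the parity of [q]
    itself, not of its remainder, so [2 m] is always a period. *)
Definition alternating (b : bool) q := transpose_if (odd q (+) b) (A (q %% m).+1).

Let AqP q : nonneg_matrix (A (q %% m).+1) /\ exists c, op_bound (mv (A (q %% m).+1)) c.
Proof. by apply: AP; rewrite ltn_mod. Qed.

Lemma alternating_ge0 b q : nonneg_matrix (alternating b q).
Proof. by apply: transpose_if_ge0; case: (AqP q). Qed.

Lemma alternating_bound b q : exists c, op_bound (mv (alternating b q)) c.
Proof.
by have [M0 [c Mc]] := AqP q; exists c; exact: transpose_if_bound.
Qed.

Lemma alternating_period b q : alternating b (m.*2 + q) = alternating b q.
Proof. by rewrite /alternating oddD odd_double -mul2n modnMDl. Qed.

(* [alternating (odd k) (k + p)] is [A ((k + p) %% m).+1], transposed if and only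
   if [p] is odd. *)
Lemma hadamard_alternating p :
  (fun i j => \prod_(k < m) alternating (odd k) (k + p) i j) =
  transpose_if (odd p) (hadamard_prod s A).
Proof.
apply/funext => i; apply/funext => j.
transitivity (\prod_(k < m) transpose_if (odd p) (A ((k + p) %% m).+1) i j).
  by apply: eq_bigr => k _; rewrite /alternating oddD addbC addbA addbb.
rewrite (prod_modn_shift p (fun k => transpose_if (odd p) (A k.+1) i j) m0).
rewrite /transpose_if /hadamard_prod /transpose /s.
by case: (odd p); rewrite big_add1 big_mkord.
Qed.

Lemma hadamard_prod_ge0 : nonneg_matrix (hadamard_prod s A).
Proof.
move=> i j; rewrite /hadamard_prod big_seq; apply: prodr_ge0 => k.
by rewrite mem_index_iota => /AP[].
Qed.

(** The [k]-th word starts at index [k] with parity [odd k], so that the [p]-th factors of all words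
    multiply to [H] or [H^T]. Words with [k > 0] enter only through their bounds, whence [m.-1]. *)
Lemma run_hadamard_alternating n (c : nat -> R) x : nneg_vec x ->
  (forall k, op_bound (run (fun p => alternating (odd k) (k + p)) n) (c k)) ->
  forall i, (run (fun p => transpose_if (odd p) (hadamard_prod s A)) n x i <=
    (\prod_(k < m.-1) c k.+1)%:E * run (alternating false) n x i)%E.
Proof.
move=> x0 Yc i.
have c0 k : 0 <= c k by case: (Yc k) => /ltW.
have Y0 k p : nonneg_matrix (alternating (odd k) (k + p)) by exact: alternating_ge0.
have Z0 p : nonneg_matrix (transpose_if (odd p) (hadamard_prod s A)).
  by apply: transpose_if_ge0; exact: hadamard_prod_ge0.
rewrite !run_decompose//; last by move=> p; exact: alternating_ge0.
rewrite -esumZl; last 2 first.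
- by rewrite lee_fin prodr_ge0.
- by move=> j; rewrite mule_ge0// run_ge0//; [move=> p; exact: alternating_ge0|exact: unit_vec_ge0].
apply: le_esum => j _; rewrite muleCA; apply: lee_wpmul2l => //.
have := run_hadamard m.-1 Y0 c0 (fun k i j => op_bound_unit i j (Yc k)) i j.
rewrite prednK//.
rewrite (@eq_run _ _ _ (fun p => transpose_if (odd p) (hadamard_prod s A)))// => p.
exact: hadamard_alternating.
Qed.

(** Apply the preceding comparison to words of length 1. *)
Lemma hadamard_prod_bound : exists c, op_bound (mv (hadamard_prod s A)) c.
Proof.
have [c Yc] := choice (fun k => op_bound_run 1
  (fun p => alternating_bound (odd k) (k + p))).
have H0 := hadamard_prod_ge0.
exists (\prod_(k < m.-1) c k.+1 * c 0%N); have [c0 _ c0P] := Yc 0%N.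
have C0 : 0 < \prod_(k < m.-1) c k.+1 by apply: prodr_gt0 => k _; case: (Yc k.+1).
split; [exact: mulr_gt0|by move=> x; exact: mv_ge0|move=> x x0].
have le1 := run_hadamard_alternating x0 Yc.
have rx0 : nneg_vec (run (alternating false) 1 x).
  by apply: run_ge0 => // p; exact: alternating_ge0.
apply: le_trans (le_ip (mv_ge0 H0 x0) (mv_ge0 H0 x0) le1 le1) _.
rewrite ip_scale// exprMn (EFinM (_ ^+ 2)) -(muleA (_ ^+ 2)%:E).
by apply: lee_wpmul2l; [rewrite lee_fin sqr_ge0|exact: c0P].
Qed.

(** [tau b] is the growth rate of the words of length [2 m] of initial parity [b]. Comparing words
    of length [2 m n] gives [<x, (H^T H)^(m n) x> <= K theta^(m n) |x|^2], and [alternating_moment]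
    turns this into a bound on [|H x|]. *)
Lemma hadamard_prod_norm (tau : bool -> R) (theta : R) x : 0 < theta ->
  (forall b, power_bound (run (alternating b) m.*2) (tau b)) ->
  \prod_(k < m) tau (odd k) = theta ^+ m ->
  nneg_vec x ->
  (ip (mv (hadamard_prod s A) x) (mv (hadamard_prod s A) x) <= theta%:E * ip x x)%E.
Proof.
move=> th0 pb tauE x0.
have [xoo|xfin] := eqVneq (ip x x) +oo%E.
  by rewrite xoo gt0_muley ?leey// lte_fin.
have {xfin} xs : (ip x x < +oo)%E by rewrite ltey.
have H0 := hadamard_prod_ge0; have [b Hb] := hadamard_prod_bound.
have mm0 : (0 < m.*2)%N by rewrite double_gt0.
pose Z p := transpose_if (odd p) (hadamard_prod s A).
have Z0 p : nonneg_matrix (Z p) by exact: transpose_if_ge0.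
have Zb p : exists c, op_bound (mv (Z p)) c by exists b; exact: transpose_if_bound.
have ZT a d : odd (a + d) -> transpose (Z a) = Z d.
  by rewrite oddD /Z; case: (odd a); case: (odd d).
have rot k : power_bound (run (fun p => alternating (odd k) (k + p)) m.*2) (tau (odd k)).
  exact: (power_bound_rotate k (alternating_ge0 (odd k)) (alternating_bound (odd k))
    mm0 (alternating_period (odd k)) (pb (odd k))).
have [C YC] := choice (fun k => proj2 (rot k)).
pose K := \prod_(k < m) C k.
(* [K] collects the constants of the [m] words and does not depend on [n]. The word of index 0 is
   estimated last, by Cauchy-Schwarz against [x]. *)
have bound n : (ip x (run Z (n * m.*2) x) <=
    (K * (theta ^+ m) ^+ n)%:E * ip x x)%E.
  have Yn k : op_bound (run (fun p => alternating (odd k) (k + p)) (n * m.*2))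
      (C k * tau (odd k) ^+ n).
    apply: op_bound_ext (YC k n) => v v0; rewrite run_periodic// => q.
    by rewrite addnCA alternating_period.
  have le1 := run_hadamard_alternating x0 Yn.
  have [c0 T0 Y0] := Yn 0%N.
  have rx0 := T0 _ x0.
  have KE : K * (theta ^+ m) ^+ n =
      \prod_(k < m.-1) (C k.+1 * tau (odd k.+1) ^+ n) * (C 0%N * tau false ^+ n).
    rewrite /K -tauE -prodrXl -big_split/= -[in LHS](prednK m0) big_ord_recl mulrC.
    by congr (_ * _).
  have Cn0 : 0 <= \prod_(k < m.-1) (C k.+1 * tau (odd k.+1) ^+ n).
    by apply: prodr_ge0 => k _; case: (Yn k.+1) => /ltW.
  have Zx0 : nneg_vec (run Z (n * m.*2) x) by exact: run_ge0.
  apply: le_trans (le_ip x0 Zx0 (fun i => lexx (x i)) le1) _.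
  have -> : ip x (fun i => (\prod_(k < m.-1) (C k.+1 * tau (odd k.+1) ^+ n))%:E *
      run (alternating false) (n * m.*2) x i)%E =
      ((\prod_(k < m.-1) (C k.+1 * tau (odd k.+1) ^+ n))%:E *
      ip x (run (alternating false) (n * m.*2) x))%E.
    rewrite -esumZl ?lee_fin//; last by move=> i; rewrite mule_ge0.
    by apply: eq_esum => i _; rewrite muleCA.
  rewrite KE EFinM -muleA; apply: lee_wpmul2l; rewrite ?lee_fin//.
  have := le_trans (esum_CauchySchwarz x0 rx0) (lee_wpmul2l (ip_ge0 x0 x0) (Y0 _ x0)).
  rewrite -!/(ip _ _) /=.
  have := ip_ge0 x0 rx0; have := ip_ge0 x0 x0; move: xs.
  have -> : run (fun p => alternating false (0 + p)) (n * m.*2) x =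
      run (alternating false) (n * m.*2) x by [].
  case: (ip x x) => [X||]// _; case: (ip x _) => [Y||]//; rewrite -?EFinM ?lee_fin.
  move=> X0 Y_ge0 YX.
  rewrite -(@ler_pXn2r _ 2) ?nnegrE ?(mulr_ge0 (ltW c0) X0)//.
  by rewrite expr2 (le_trans YX)// le_eqVlt; apply/orP; left; apply/eqP; ring.
have xx0 := ip_ge0 x0 x0; have hh0 := ip_ge0 (mv_ge0 H0 x0) (mv_ge0 H0 x0).
have hs : (ip (mv (hadamard_prod s A) x) (mv (hadamard_prod s A) x) < +oo)%E.
  have [_ _ /(_ _ x0)/le_lt_trans] := Hb; apply.
  by apply: lte_mul_pinfty; rewrite ?lee_fin ?sqr_ge0.
have grow n := alternating_moment (n * m) Z0 Zb ZT x0 xs; rewrite [Z 0%N]/= in grow.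
have {}bound n : fine (ip x (run Z (n * m + n * m) x)) <=
    K * (theta ^+ m) ^+ n * fine (ip x x).
  have := bound n; rewrite -addnn mulnDr.
  have := ip_ge0 x0 (run_ge0 (n * m + n * m) Z0 x0); move: xs xx0.
  by case: (ip x x) => [X||]// _ _; case: (ip x _) => [Y||].
have hb : (ip (mv (hadamard_prod s A) x) (mv (hadamard_prod s A) x) <= (b ^+ 2)%:E * ip x x)%E.
  by case: Hb => _ _; exact.
move: hb xs xx0 hs hh0 grow bound.
case: (ip x x) => [a0||]//; case: (ip (mv _ _) _) => [a1||]// hb _ + _.
rewrite !lee_fin/= => a00 a10 grow bound.
(* If [x] has norm 0, the crude bound [hb] already shows that [H x] has norm 0. *)
have [a0E|a0n] := eqVneq a0 0.
  by move: hb; rewrite a0E -!EFinM !lee_fin !mulr0.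
have {}a00 : 0 < a0 by rewrite lt0r a0n.
rewrite -ler_pdivrMr//.
rewrite -(@ler_pXn2r _ m) ?nnegrE ?divr_ge0 ?(ltW th0) ?(ltW a00)//.
(* The [m]-th powers of [a1 / a0] and [theta] are compared through their own [n]-th powers, which
   eliminates [K]. *)
apply: (@le_of_power_le R K); rewrite ?exprn_ge0 ?exprn_gt0 ?divr_ge0 ?(ltW a00)// => n.
rewrite -exprM (mulnC m) expr_div_n ler_pdivrMr ?exprn_gt0// -(ler_pM2r a00).
apply: le_trans (grow n) _.
apply: le_trans (ler_wpM2l (exprn_ge0 (n * m) (ltW a00)) (bound n)) _.
by rewrite mulrCA mulrA.
Qed.

End HadamardProduct.
End AlternatingProducts.

(** * Adjoint invariance of the spectral radius, and norm estimates *)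

Section SpectralRadius.
Context {R : realType} {I : countType}.
Implicit Types (H P Q : I -> I -> R) (F : nat -> I -> I -> R).

(** Every number above the spectral radius of [Q] is a power bound of [Q], hence of its adjoint
    [P]. *)
Lemma le_matrix_rho P Q : nonneg_matrix P -> nonneg_matrix Q ->
  (exists c, op_bound (mv Q) c) ->
  (forall v w, nneg_vec v -> nneg_vec w -> ip (mv Q v) w = ip v (mv P w)) ->
  matrix_rho P <= matrix_rho Q.
Proof.
move=> P0 Q0 [c Qc] PQ; apply/ler_addgt0Pr => e e0.
apply: matrix_rho_le => //.
have Qe : matrix_rho Q < matrix_rho Q + e by rewrite ltrDl.
apply: power_bound_adjoint (power_bound_of_rho Q0 Qc Qe) _ PQ => v.
exact: mv_ge0.
Qed.

Lemma foldr_mv_ge0 (s : seq nat) F v : (forall k, k \in s -> nonneg_matrix (F k)) ->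
  nneg_vec v -> nneg_vec (foldr (fun k => mv (F k)) v s).
Proof.
elim: s => //= k s IH F0 v0; apply: mv_ge0; first exact/F0/mem_head.
by apply: IH => // l ls; apply: F0; rewrite inE ls orbT.
Qed.

Lemma foldr_mv_adjoint (s : seq nat) F v w :
  (forall k, k \in s -> nonneg_matrix (F k)) -> nneg_vec v -> nneg_vec w ->
  ip (foldr (fun k => mv (F k)) v s) w =
  ip v (foldr (fun k => mv (transpose (F k))) w (rev s)).
Proof.
move=> + v0; elim: s w => // k s IH w F0 w0.
have Fs0 l : l \in s -> nonneg_matrix (F l).
  by move=> ls; apply: F0; rewrite inE ls orbT.
have Fk0 := F0 k (mem_head _ _).
rewrite [foldr _ v _]/= (mv_adjoint Fk0 (foldr_mv_ge0 Fs0 v0) w0).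
rewrite rev_cons foldr_rcons; apply: IH => //.
by apply: mv_ge0 => //; exact: transpose_ge0.
Qed.

(** Entrywise [|H x| <= H |x|], so an estimate on non-negative vectors controls the complex operator
    norm. *)
Lemma matrix_norm_le H c (theta : R) : nonneg_matrix H -> op_bound (mv H) c ->
  0 < theta ->
  (forall x, nneg_vec x -> (ip (mv H x) (mv H x) <= theta%:E * ip x x)%E) ->
  matrix_norm H ^+ 2 <= theta.
Proof.
move=> H0 Hc th0 Hth; rewrite -(sqr_sqrtr (ltW th0)).
have Hx x : l2 x -> l2norm x <= 1 -> l2norm (matrix_op H x) <= Num.sqrt theta.
  move=> xs x1; have xabs0 := cabs_ge0 x.
  have [|_ le1] := @l2norm_le _ _ x (matrix_op H x) (Num.sqrt theta) (sqrtr_ge0 _) xs.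
    rewrite sqr_sqrtr ?(ltW th0)//; apply: le_trans (Hth _ xabs0).
    by apply: le_ip; [exact: cabs_ge0..| |]; move=> i; exact: (cabs_matrix_op H0 Hc).
  by apply: le_trans le1 _; rewrite ler_piMr ?sqrtr_ge0.
have [norm_le norm_ge0] : matrix_norm H <= Num.sqrt theta /\ 0 <= matrix_norm H.
  rewrite /matrix_norm /opnorm; set E := (X in sup X).
  have [->|/set0P[y Ey]] := eqVneq E set0; first by rewrite sup0 sqrtr_ge0.
  have ubE : ubound E (Num.sqrt theta) by move=> _ [x [xs x1] <-]; exact: Hx.
  split; first by apply: ge_sup => //; exists y.
  have y0 : 0 <= y by case: Ey => x _ <-; exact: l2norm_ge0.
  by apply: le_trans y0 _; apply: ub_le_sup Ey; exists (Num.sqrt theta).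
by rewrite lerXn2r// nnegrE sqrtr_ge0.
Qed.

Lemma le_mul_of_gt (X a b : R) : 0 <= a -> 0 <= b ->
  (forall s t, a < s -> b < t -> X <= s * t) -> X <= a * b.
Proof.
move=> a0 b0 Xst; apply/ler_addgt0Pr => e e0.
(* For [d <= 1], [(a + d) * (b + d) <= a * b + d * (a + b + 1)]. *)
pose d := Num.min 1 (e / (a + b + 1)).
have ab0 : 0 < a + b + 1 by lra.
have d0 : 0 < d by rewrite lt_min ltr01 divr_gt0.
have d1 : d <= 1 by rewrite ge_min lexx.
have de : d * (a + b + 1) <= e by rewrite -ler_pdivlMr// ge_min lexx orbT.
apply: le_trans (Xst (a + d) (b + d) _ _) _; rewrite ?ltrDl//; nra.
Qed.

End SpectralRadius.

Lemma eq_in_foldr (T : eqType) (U : Type) (f g : T -> U -> U) (z : U) (s : seq T) :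
  {in s, f =1 g} -> foldr f z s = foldr g z s.
Proof.
elim: s => //= x s IH fg; rewrite IH ?fg ?mem_head// => y ys.
by apply: fg; rewrite inE ys orbT.
Qed.

(** * The even and the odd case *)

Section HadamardNorm.
Context {R : realType} {I : countType}.
Variables (m : nat) (A : nat -> I -> I -> R).
Hypotheses (m0 : (0 < m)%N)
  (AP : forall k, (1 <= k <= m)%N ->
     nonneg_matrix (A k) /\ exists c, op_bound (mv (A k)) c).

Let s := index_iota 1 m.+1.

Let sE : s = map succn (iota 0 m).
Proof. by rewrite /s /index_iota subSS subn0 (iotaDl 1 0). Qed.

Let todd := transpose_odd A.
Let teven := transpose_even A.

Let transpose_ifP b k : k \in s -> nonneg_matrix (transpose_if b (A k)) /\
  exists c, op_bound (mv (transpose_if b (A k))) c.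
Proof.
rewrite mem_index_iota ltnS => /AP[Ak0 [c Akc]].
by split; [exact: transpose_if_ge0|exists c; exact: transpose_if_bound].
Qed.

Let toddP k : k \in s -> nonneg_matrix (todd k) /\ exists c, op_bound (mv (todd k)) c.
Proof. exact: transpose_ifP. Qed.

Let tevenE k : teven k = transpose_if (~~ odd k) (A k).
Proof. by rewrite /teven /transpose_even; case: odd. Qed.

Let tevenP k : k \in s -> nonneg_matrix (teven k) /\ exists c, op_bound (mv (teven k)) c.
Proof. by rewrite tevenE; exact: transpose_ifP. Qed.

Let foldr_alternating b F v :
  (forall p, (p < m)%N -> F p.+1 = transpose (alternating m A b p)) ->
  foldr (fun k => mv (F k)) v s =
  foldr (fun p => mv (transpose (alternating m A b p))) v (iota 0 m).
Proof.
move=> FE; rewrite sE foldr_map; apply: eq_in_foldr => p.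
by rewrite mem_iota => /andP[_ pm]; apply/funext => w; rewrite /= FE.
Qed.

(** A product applies its last factor first, whereas [run] applies the index 0 first; passing to the
    adjoint reverses the order and transposes each factor. *)
Let power_bound_alternating b L P t : power_bound (mv P) t ->
  (forall v, nneg_vec v -> mv P v =
     foldr (fun p => mv (transpose (alternating m A b p))) v (iota 0 L)) ->
  power_bound (run (alternating m A b) L) t.
Proof.
move=> Pt PE; have Z0 := alternating_ge0 m0 AP b.
apply: power_bound_adjoint Pt _ _ => [v v0|v w v0 w0]; first exact: run_ge0.
by rewrite PE// ipC -run_adjoint// ipC.
Qed.

(** For even [m] the alternating words have period [m], so those of length [2 m] are squares and
    their rates are [t1 ^+ 2] and [t2 ^+ 2]. Each parity occurs for [m / 2] starting points, which
    gives [theta = t1 * t2]. *)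
Lemma norm_hadamard_even : ~~ odd m ->
  matrix_norm (hadamard_prod s A) ^+ 2 <=
  matrix_rho (matrix_prod s todd) * matrix_rho (matrix_prod s teven).
Proof.
move=> mE.
have [P0 [c1 Pc] PE] := matrix_prodP toddP.
have [Q0 [c2 Qc] QE] := matrix_prodP tevenP.
have rho1 := matrix_rho_ge0 P0 (op_bound_power Pc).
have rho2 := matrix_rho_ge0 Q0 (op_bound_power Qc).
apply: le_mul_of_gt => // t1 t2 Pt Qt.
have t10 := le_lt_trans rho1 Pt; have t20 := le_lt_trans rho2 Qt.
have [c Hc] := hadamard_prod_bound m0 AP.
apply: (matrix_norm_le (hadamard_prod_ge0 AP) Hc); first exact: mulr_gt0.
move=> x; apply: (hadamard_prod_norm m0 AP (tau := fun b => if b then t2 ^+ 2 else t1 ^+ 2)).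
- exact: mulr_gt0.
- have double b t : power_bound (run (alternating m A b) m) t ->
      power_bound (run (alternating m A b) m.*2) (t ^+ 2).
    move=> /power_bound_sqr; apply: power_bound_ext => v _.
    rewrite -addnn runD /=; apply: eq_run => q.
    by rewrite /alternating oddD (negPf mE) modnDl.
  case; apply: double.
    apply: power_bound_alternating (power_bound_of_rho Q0 Qc Qt) _ => v v0.
    rewrite QE//; apply: foldr_alternating => p pm.
    by rewrite /alternating modn_small// tevenE /=; case: (odd p).
  apply: power_bound_alternating (power_bound_of_rho P0 Pc Pt) _ => v v0.
  rewrite PE//; apply: foldr_alternating => p pm.
  by rewrite /alternating modn_small// /todd /transpose_odd /=; case: (odd p).
- rewrite -(odd_double_half m) (negPf mE) add0n.
  elim: (m./2) => [|h IH]; first by rewrite big_ord0 expr0.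
  rewrite doubleS !big_ord_recr/= IH odd_double/= -mulrA -exprMn -exprD.
  by rewrite addn2.
Qed.

(** For odd [m] the parity flips after [m] factors, so a word of length [2 m] contains each matrix
    once plain and once transposed. Rotation by [m] exchanges the initial parities, so a single rate
    [t] serves for both. *)
Lemma norm_hadamard_odd : odd m ->
  matrix_norm (hadamard_prod s A) ^+ 2 <=
  matrix_rho (matrix_mul (matrix_prod s teven) (matrix_prod s todd)).
Proof.
move=> mO.
have [P0 [c1 Pc] PE] := matrix_prodP toddP.
have [Q0 [c2 Qc] QE] := matrix_prodP tevenP.
have QP0 := matrix_mul_ge0 Q0 P0.
have QPE v : nneg_vec v -> mv (matrix_mul (matrix_prod s teven) (matrix_prod s todd)) v =
    mv (matrix_prod s teven) (mv (matrix_prod s todd) v) := mv_matrix_mul Q0 P0 Qc Pc.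
have QPc : op_bound (mv (matrix_mul (matrix_prod s teven) (matrix_prod s todd))) (c2 * c1).
  by apply: op_bound_ext (op_bound_comp Qc Pc) => v v0; rewrite QPE.
have rho0 := matrix_rho_ge0 QP0 (op_bound_power QPc).
apply/ler_addgt0Pr => e e0; set t := _ + e.
have t0 : 0 < t by rewrite ltr_wpDl.
have pbt : power_bound (mv (matrix_mul (matrix_prod s teven) (matrix_prod s todd))) t.
  by apply: (power_bound_of_rho QP0 QPc); rewrite ltrDl.
have [c Hc] := hadamard_prod_bound m0 AP.
apply: (matrix_norm_le (hadamard_prod_ge0 AP) Hc) => // x.
have pb1 : power_bound (run (alternating m A true) m.*2) t.
  apply: power_bound_alternating pbt _ => v v0.
  rewrite QPE// QE; last exact: mv_ge0.
  rewrite PE// -addnn iotaD foldr_cat add0n -[X in iota X m](addn0 m) iotaDl foldr_map.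
  rewrite (@foldr_alternating true); last first.
    by move=> p pm; rewrite /alternating modn_small// tevenE /=; case: (odd p).
  congr foldr; rewrite sE foldr_map; apply: eq_in_foldr => p.
  rewrite mem_iota => /andP[_ pm] /=; congr mv.
  rewrite /alternating modnDl modn_small// oddD mO /todd /transpose_odd /=.
  by case: (odd p).
apply: (hadamard_prod_norm m0 AP (tau := fun=> t)) => //.
- case=> //.
  have := power_bound_rotate m (alternating_ge0 m0 AP true) (alternating_bound m0 AP true).
  move=> /(_ m.*2 t); rewrite double_gt0 => /(_ m0 (alternating_period m A true) pb1).
  apply: power_bound_ext => v _; apply: eq_run => q.
  by rewrite /alternating modnDl oddD mO; case: (odd q).
- by rewrite prodr_const card_ord.
Qed.

(** The two products are adjoint to each other: transposition reverses the order and exchanges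
    [transpose_even] with [transpose_odd]. *)
Lemma matrix_rho_transpose_prod :
  matrix_rho (matrix_prod s teven) = matrix_rho (matrix_prod (rev s) todd).
Proof.
have [Q0 Qc QE] := matrix_prodP tevenP.
have toddP' k : k \in rev s -> nonneg_matrix (todd k) /\ exists c, op_bound (mv (todd k)) c.
  by rewrite mem_rev; exact: toddP.
have [P0 Pc PE] := matrix_prodP toddP'.
have adj v w : nneg_vec v -> nneg_vec w ->
    ip (mv (matrix_prod s teven) v) w = ip v (mv (matrix_prod (rev s) todd) w).
  move=> v0 w0; rewrite QE// PE// foldr_mv_adjoint//; last first.
    by move=> k /tevenP[].
  congr ip; apply: eq_in_foldr => k _; congr mv.
  by rewrite tevenE /todd /transpose_odd; case: odd.
apply/eqP; rewrite eq_le; apply/andP; split; apply: le_matrix_rho => // v w v0 w0.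
by rewrite ipC -adj// ipC.
Qed.

End HadamardNorm.

Theorem theorem3p10 (R : realType) (r : index_set) (m : nat)
    (A : nat -> r -> r -> R) :
  (0 < m)%N ->
  (forall k, (1 <= k <= m)%N -> nonneg_matrix (A k) /\ defines_operator (A k)) ->
  let s := index_iota 1 m.+1 in
  (~~ odd m ->
     matrix_norm (hadamard_prod s A) ^+ 2
       <= matrix_rho (matrix_prod s (transpose_odd A))
          * matrix_rho (matrix_prod s (transpose_even A))
     /\ matrix_rho (matrix_prod s (transpose_odd A))
          * matrix_rho (matrix_prod s (transpose_even A))
        = matrix_rho (matrix_prod s (transpose_odd A))
          * matrix_rho (matrix_prod (rev s) (transpose_odd A)))
  /\
  (odd m ->
     matrix_norm (hadamard_prod s A) ^+ 2
       <= matrix_rho (matrix_mul (matrix_prod s (transpose_even A))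
                                 (matrix_prod s (transpose_odd A)))).
Proof.
move=> m0 Adef s.
have AP k : (1 <= k <= m)%N -> nonneg_matrix (A k) /\ exists c, op_bound (mv (A k)) c.
  by move=> /Adef[Ak0 Akd]; split=> //; exact: defines_operator_bounded.
split=> [mE|mO]; last exact: norm_hadamard_odd.
split; first exact: norm_hadamard_even.
by congr (_ * _); exact: matrix_rho_transpose_prod.
Qed.
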